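(* Let $\mu\ge-1/2$, $\alpha\in(0,\pi)$, $c_1=\cot\alpha$, $c_2=\csc\alpha$, $C_{\alpha,\mu}=e^{i(1+\mu)(\pi/2-\alpha)}/\sin\alpha$, and let $3/2<\eta<\mu+2$. Assume that $f\in\mathcal{K}'_\mu(\mathbb{R}_+)$ can be decomposed as $f=g+h$, where $h\in\mathcal{E}'(\mathbb{R}_+)$ and $g$ is a function on $\mathbb{R}_+$ satisfying: (i) on every interval $0<x<X$ ($X<\infty$), $x^{\mu+1/2}g(x)$ is Lebesgue integrable; (ii) there exists a complex number $\delta$ such that $$\lim_{x\to\infty}e^{-\frac i2x^2c_1}x^{\eta-\frac12}g(x)=\delta\,\frac{c_2^{\frac32-\eta}}{C_{\alpha,\mu}} .$$ Then $$\lim_{\xi\to0^+}e^{i\xi^2c_1/2}\,\xi^{3/2-\eta}\,H_\mu^\alpha f(\xi)=\delta\,H(\mu,\eta),\qquad H(\mu,\eta)=\frac{\Gamma(1+\mu/2-\eta/2)}{2^{\eta-1}\Gamma(\mu/2+\eta/2)} .$$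
   Context: $\mathbb{R}_+=(0,\infty)$, $\mathbb{N}_0=\{0,1,2,\dots\}$, $D=d/dx$. For $\mu\ge-1/2$, $\mathcal{K}_\mu(\mathbb{R}_+)$ is the space of smooth $\varphi:\mathbb{R}_+\to\mathbb{C}$ with $\gamma^\mu_{m,k}(\varphi)=\sup_{x>0}|x^m(x^{-1}D)^k(x^{-\mu-1/2}\varphi(x))|<\infty$ for all $m,k\in\mathbb{N}_0$, with the Fréchet topology given by the norms $\gamma^\mu_r(\varphi)=\max_{0\le m,k\le r}\gamma^\mu_{m,k}(\varphi)$. $\mathcal{K}'_\mu(\mathbb{R}_+)$ is its topological dual. Locally integrable functions $g$ of slow growth at infinity with $x^{\mu+1/2}g(x)$ integrable on $(0,1)$ are identified with elements of $\mathcal{K}'_\mu(\mathbb{R}_+)$ via $\langle g,\varphi\rangle=\int_0^\infty g(x)\varphi(x)\,dx$. $\mathcal{E}'(\mathbb{R}_+)$ is the space of distributions with compact support in $\mathbb{R}_+$ (the dual of $C^\infty(\mathbb{R}_+)$); its elements are elements of $\mathcal{K}'_\mu(\mathbb{R}_+)$. Fractional Hankel transform (FrHT): with $$K_\alpha(x,\xi)=C_{\alpha,\mu}e^{-i\frac{x^2+\xi^2}{2}c_1}\sqrt{x\xi c_2}\,J_\mu(x\xi c_2),$$ which for $\alpha=\pi/2$ is $\sqrt{x\xi}J_\mu(x\xi)$ ($J_\mu$ the Bessel function of the first kind of order $\mu$), a function $g$ has FrHT $H_\mu^\alpha g(\xi)=\int_0^\infty K_\alpha(x,\xi)g(x)\,dx$,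 $\xi\in\mathbb{R}_+$. On $\mathcal{K}'_\mu(\mathbb{R}_+)$ the FrHT is defined by $\langle H_\mu^\alpha f,\varphi\rangle=\langle f,H_\mu^\alpha\varphi\rangle$, $\varphi\in\mathcal{K}_\mu(\mathbb{R}_+)$. For $h\in\mathcal{E}'(\mathbb{R}_+)$ the FrHT is the smooth function $H_\mu^\alpha h(\xi)=\langle h(x),K_\alpha(x,\xi)\rangle$, $\xi\in\mathbb{R}_+$. Thus for $f=g+h$ as in the claim, $H_\mu^\alpha f(\xi)=\int_0^\infty K_\alpha(x,\xi)g(x)\,dx+\langle h(x),K_\alpha(x,\xi)\rangle$. *)

(* Defs.v *)
From HB Require Import structures.
From mathcomp Require Import all_boot all_order all_algebra.
From mathcomp Require Import all_classical all_reals all_analysis.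
From mathcomp Require Import complex.

Set Implicit Arguments.
Unset Strict Implicit.
Unset Printing Implicit Defensive.

Import Order.TTheory GRing.Theory Num.Theory.
Import numFieldNormedType.Exports.

Local Open Scope classical_set_scope.
Local Open Scope ring_scope.
Local Open Scope complex_scope.

(* Functions on R_+ = ]0, +oo[ are represented by total functions on R; every
   definition below looks only at their values (or germs) at points x > 0. *)

Section ComplexValued.
Context {R : realType}.
Implicit Types (F : R -> R[i]) (D : set R).

Definition expi (t : R) : R[i] := cos t +i* sin t.

(* The completed measure is used because integrable functions are Lebesgue
   measurable, while lebesgue_measure lives on the Borel sigma-algebra. *)
Definition cintegrable D F : Prop :=
  (@completed_lebesgue_measure R).-integrable D
    (fun x => (complex.Re (F x))%:E) /\
  (@completed_lebesgue_measure R).-integrable D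
    (fun x => (complex.Im (F x))%:E).

Definition cintegral D F : R[i] :=
  (\int[@completed_lebesgue_measure R]_(x in D) complex.Re (F x)) +i*
  (\int[@completed_lebesgue_measure R]_(x in D) complex.Im (F x)).

Definition cderive F : R -> R[i] := fun x =>
  derive1 (fun y => complex.Re (F y)) x +i* derive1 (fun y => complex.Im (F y)) x.

Definition smooth_on_Rplus F : Prop :=
  forall (n : nat) (x : R), 0 < x ->
    derivable (fun y => complex.Re (iter n cderive F y)) x 1 /\
    derivable (fun y => complex.Im (iter n cderive F y)) x 1.

End ComplexValued.

Section SpecialFunctions.
Context {R : realType}.
Implicit Types (s mu x eta alpha : R).

(* Euler's integral: meaningful for s > 0, the only case occurring below. *)
Definition Gamma s : R :=
  \int[@lebesgue_measure R]_(t in `]0, +oo[) (t `^ (s - 1) * expR (- t)).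

(* J_mu (x), for x > 0 and mu > -1 *)
Definition besselJ mu x : R :=
  (x / 2) `^ mu *
  limn (series (fun k : nat =>
    (-1) ^+ k / (k`!%:R * Gamma (mu + k%:R + 1)) * (x / 2) ^+ (2 * k))).

Definition cotan alpha : R := cos alpha / sin alpha.
Definition cosec alpha : R := (sin alpha)^-1.

Definition Hconst mu eta : R :=
  Gamma (1 + mu / 2 - eta / 2) /
  (2 `^ (eta - 1) * Gamma (mu / 2 + eta / 2)).

End SpecialFunctions.

Section KmuSpace.
Context {R : realType}.
Implicit Types (mu : R) (m k r : nat) (phi psi : R -> R[i]).

Definition xinvD phi : R -> R[i] := fun x => (x^-1)%:C * cderive phi x.

Definition gamma_mk mu m k phi : \bar R :=
  ereal_sup [set (Normc.normc ((x ^+ m)%:C *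
      iter k xinvD (fun y => (y `^ (- mu - 1 / 2))%:C * phi y) x))%:E
    | x in `]0, +oo[].

Definition Kmu mu phi : Prop :=
  smooth_on_Rplus phi /\ forall m k, (gamma_mk mu m k phi < +oo)%E.

Definition gamma_r mu r phi : \bar R :=
  \big[maxe/0%E]_(m < r.+1) \big[maxe/0%E]_(k < r.+1) gamma_mk mu m k phi.

(* Linear functionals on K_mu, continuous for the topology whose basic
   neighbourhoods of phi0 are the balls of the norms gamma_r.  Continuity makes
   the value at phi depend on the restriction of phi to R_+ only. *)
Definition Kmu_dual mu (f : (R -> R[i]) -> R[i]) : Prop :=
  (forall (a : R[i]) phi psi, Kmu mu phi -> Kmu mu psi ->
     f (fun x => a * phi x + psi x) = a * f phi + f psi) /\
  (forall phi0, Kmu mu phi0 -> forall e : R, 0 < e ->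
     exists r, exists2 d : R, 0 < d &
       forall phi, Kmu mu phi ->
         (gamma_r mu r (fun x => (phi x - phi0 x)%R) < d%:E)%E ->
         Normc.normc (f phi - f phi0) < e).

(* E'(R_+), the dual of C^oo(R_+) with the topology of uniform convergence of
   all derivatives on compact subsets of R_+. *)
Definition compact_distribution (h : (R -> R[i]) -> R[i]) : Prop :=
  (forall (a : R[i]) phi psi, smooth_on_Rplus phi -> smooth_on_Rplus psi ->
     h (fun x => a * phi x + psi x) = a * h phi + h psi) /\
  (forall phi0, smooth_on_Rplus phi0 -> forall e : R, 0 < e ->
     exists (K : set R) (n : nat) (d : R),
       [/\ compact K, K `<=` `]0, +oo[, 0 < d &
         forall phi, smooth_on_Rplus phi ->
           (forall k x, (k <= n)%N -> K x ->
              Normc.normc (iter k cderive (fun y => phi y - phi0 y) x) < d) ->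
           Normc.normc (h phi - h phi0) < e]).

Definition pairing (g phi : R -> R[i]) : R[i] :=
  cintegral `]0, +oo[ (fun x => g x * phi x).

End KmuSpace.

Section FractionalHankel.
Context {R : realType}.
Implicit Types (mu alpha x xi : R).

Definition frht_const alpha mu : R[i] :=
  expi ((1 + mu) * (pi / 2 - alpha)) / (sin alpha)%:C.

Definition frht_kernel mu alpha x xi : R[i] :=
  frht_const alpha mu *
  expi (- ((x ^+ 2 + xi ^+ 2) / 2 * cotan alpha)) *
  (Num.sqrt (x * xi * cosec alpha) *
   besselJ mu (x * xi * cosec alpha))%:C.

Definition frht_fun mu alpha (g : R -> R[i]) xi : R[i] :=
  cintegral `]0, +oo[ (fun x => frht_kernel mu alpha x xi * g x).

Definition frht_compact mu alpha (h : (R -> R[i]) -> R[i]) xi : R[i] :=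
  h (fun x => frht_kernel mu alpha x xi).

Definition frht_sum mu alpha (g : R -> R[i]) (h : (R -> R[i]) -> R[i]) xi :
    R[i] :=
  frht_fun mu alpha g xi + frht_compact mu alpha h xi.

End FractionalHankel.

(* Main.v *)
Require Import Defs.
From HB Require Import structures.
From mathcomp Require Import all_boot all_order all_algebra.
From mathcomp Require Import all_classical all_reals all_analysis.
From mathcomp Require Import complex measurable_realfun.
From mathcomp Require Import ring lra.

Set Implicit Arguments.
Unset Strict Implicit.
Unset Printing Implicit Defensive.

Import Order.TTheory GRing.Theory Num.Theory.
Import numFieldNormedType.Exports.

Local Open Scope classical_set_scope.
Local Open Scope ring_scope.
Local Open Scope complex_scope.

(** Up to chirps of modulus one and constants, the transform of [g] at [xi] is
    the integral of [u x * w (xi c2 x)] with [u x = exp (- i x^2 c1 / 2) g x] and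
    [w y = sqrt y J_mu y].  Since [w] is [O(y^(mu+1/2))] at 0 and bounded at infinity,
    replacing [u] by its asymptotic equivalent [L x^(1/2-eta)] costs
    [o(xi^(eta-3/2))], and for [u = L x^(1/2-eta)] scaling leaves the absolutely
    convergent integral of [y^(1-eta) J_mu y].  The latter is evaluated by writing
    [y^(-mu-eta)] as a mixture of Gaussians and exchanging the integrations:
    Weber's integral of [y^(mu+1) J_mu y exp (- t y^2)] turns it into a Gamma
    integral.  The compactly supported part contributes [O(xi^(mu+1/2))], because the
    kernel is [xi^(mu+1/2)] times a function all of whose [x]-derivatives are bounded
    on compacts uniformly for [xi <= 1]; this is negligible as [eta < mu + 2]. *)

(** The lower bound on [eta] makes a bounded function times [y^(1/2 - eta)] integrable at infinity,
    the upper bound makes [y^(mu + 1 - eta)] integrable at 0. Everything is therefore absolutely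
    convergent, and no cancellation between oscillations of the Bessel function is exploited.
    Boundedness of [w] at infinity comes from an energy estimate for its differential equation, not
    from asymptotic expansions. Two measures coexist. The function [g] is only Lebesgue measurable,
    so its integrals use the completed measure, while the Gamma and Bessel integrals and Fubini live
    on the Borel sigma-algebra; only explicit Borel integrands are carried from one to the other.
    Changes of variables are proved first for nonnegative continuous integrands, by exhausting the
    half-line, where no integrability is required; signed integrands follow by difference. *)

Section RealIntegrable.
Context d (T : measurableType d) (R : realType) (mu : {measure set T -> \bar R}).
Variables (D : set T) (mD : measurable D).
Implicit Types f g : T -> R.

Lemma le_integrableR f g : measurable_fun D f ->
  (forall x, D x -> `|f x| <= g x) ->
  mu.-integrable D (EFin \o g) -> mu.-integrable D (EFin \o f).
Proof.
move=> mf fg; apply: le_integrable => //; first exact/measurable_EFinP.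
by move=> x Dx /=; rewrite lee_fin (le_trans (fg x Dx))// ler_norm.
Qed.

Lemma integrableZD f g (a b : R) : mu.-integrable D (EFin \o f) ->
  mu.-integrable D (EFin \o g) ->
  mu.-integrable D (EFin \o (fun x => a * f x + b * g x)).
Proof.
move=> If Ig; have := integrableD mD (integrableZl mD a If) (integrableZl mD b Ig).
by apply: eq_integrable.
Qed.

Lemma integrableZR f (a : R) : mu.-integrable D (EFin \o f) ->
  mu.-integrable D (EFin \o (fun x => a * f x)).
Proof. by move=> If; have := integrableZl mD a If; apply: eq_integrable. Qed.

Lemma RintegralZD f g (a b : R) : mu.-integrable D (EFin \o f) ->
  mu.-integrable D (EFin \o g) ->
  \int[mu]_(x in D) (a * f x + b * g x) =
  a * \int[mu]_(x in D) f x + b * \int[mu]_(x in D) g x.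
Proof.
move=> If Ig; rewrite RintegralD ?RintegralZl//.
- by have := integrableZl mD a If; apply: eq_integrable.
- by have := integrableZl mD b Ig; apply: eq_integrable.
Qed.

Lemma measurable_integrableR f : mu.-integrable D (EFin \o f) -> measurable_fun D f.
Proof. by move=> /measurable_int/measurable_EFinP. Qed.

End RealIntegrable.

(** * Exhaustion of the half-line and changes of variables on it *)

Section HalfLine.
Context {R : realType}.
Implicit Types (f F G : R -> R) (a b p s x y : R).
Local Notation Rpos := (`]0, +oo[%classic : set R).
Local Notation Icc a b := ([set` Interval (BLeft a%R) (BRight b%R)] : set R).
Local Notation lmu := (@lebesgue_measure R).

Lemma is_deriveD_fun f F x (a b : R) : is_derive x 1 f a -> is_derive x 1 F b ->
  is_derive x 1 (fun y => f y + F y) (a + b).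
Proof. by move=> df dF; exact: is_deriveD. Qed.

Lemma is_deriveM_fun f F x (a b : R) : is_derive x 1 f a -> is_derive x 1 F b ->
  is_derive x 1 (fun y => f y * F y) (a * F x + f x * b).
Proof.
move=> df dF; apply: (is_derive_eq (is_deriveM df dF)).
by rewrite addrC /GRing.scale/= (mulrC a).
Qed.

Lemma is_derive_comp_fun f F x (a b : R) : is_derive (F x) 1 f a ->
  is_derive x 1 F b -> is_derive x 1 (fun y => f (F y)) (a * b).
Proof. by move=> df dF; exact: is_derive1_comp. Qed.

Lemma is_derive_continuous f x (a : R) : is_derive x 1 f a -> {for x, continuous f}.
Proof. by case=> df _; apply: differentiable_continuous; apply/derivable1_diffP. Qed.

Lemma is_derive_sqr x : is_derive x 1 (fun y => y ^+ 2) (2 * x).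
Proof.
by apply: (is_derive_eq (is_deriveX 2 (is_derive_id x 1))); rewrite /= expr1 /GRing.scale/= mulr1.
Qed.

Lemma powRDpos x p s : 0 < x -> x `^ (p + s) = x `^ p * x `^ s.
Proof. by move=> x0; apply: powRD; apply/implyP => _; rewrite gt_eqF. Qed.

Lemma continuous_powR p x : 0 < x -> {for x, continuous (fun y => y `^ p)}.
Proof. by move=> x0; apply: is_derive_continuous; exact: is_derive1_powR. Qed.

Lemma halfline_continuous_measurable f :
  (forall x, 0 < x -> {for x, continuous f}) ->
  measurable_fun Rpos f.
Proof.
move=> cf; apply: open_continuous_measurable_fun; first exact: interval_open.
by move=> x; rewrite inE/= in_itv/= andbT => /cf.
Qed.

Lemma halfline_bigcup (u v : nat -> R) :
  u n @[n --> \oo] --> 0 -> v n @[n --> \oo] --> +oo ->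
  (forall n, 0 < u n) ->
  \bigcup_n `[u n, v n]%classic = Rpos.
Proof.
move=> u0 voo un; apply/seteqP; split => [x [n _]|x]/=.
  by rewrite !in_itv/= andbT => /andP[+ _]; apply: lt_le_trans.
rewrite in_itv/= andbT => x0.
have Hu : \forall n \near \oo, u n < x.
  by move/cvgrPdist_lt: u0 => /(_ x x0); apply: filterS => n;
     rewrite sub0r normrN gtr0_norm.
have Hv : \forall n \near \oo, x <= v n by move/cvgryPge : voo; apply.
have : \forall n \near \oo, u n < x /\ x <= v n by near=> n; split; near: n.
move=> [N _ /(_ N (leqnn N)) [h1 h2]].
by exists N => //=; rewrite in_itv/= (ltW h1).
Unshelve. all: by end_near. Qed.

(** Monotone convergence along growing compact intervals. Nonnegativity stands in for integrability,
    so the limit may be infinite. *)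
Lemma halfline_cvg_integral (u v : nat -> R) (f : R -> \bar R) :
  u n @[n --> \oo] --> 0 -> v n @[n --> \oo] --> +oo ->
  (forall n, 0 < u n) -> nonincreasing_seq u -> nondecreasing_seq v ->
  measurable_fun Rpos f -> (forall x, 0 < x -> (0 <= f x)%E) ->
  (\int[lmu]_(x in `[u n, v n]) f x)%E @[n --> \oo] -->
  (\int[lmu]_(x in Rpos) f x)%E.
Proof.
move=> u0 voo un du iv mf f0.
have HD : forall n, `[u n, v n]%classic `<=` Rpos.
  move=> n x/=; rewrite !in_itv/= andbT => /andP[+ _]; exact: lt_le_trans.
rewrite -(halfline_bigcup u0 voo un).
apply: ge0_nondecreasing_set_cvg_integral.
- move=> m n mn; rewrite subsetEset => x/=; rewrite !in_itv/= => /andP[h1 h2].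
  by rewrite (le_trans (du _ _ mn) h1) (le_trans h2)// iv.
- by move=> i; exact: measurable_itv.
- by move=> i; apply: measurable_funS mf => //; exact: HD.
- by move=> i x /HD/=; rewrite in_itv/= andbT => /f0.
Qed.

Lemma cvg_succr : (fun n : nat => n.+1%:R : R) @ \oo --> +oo.
Proof.
apply/cvgryPge => A; near=> n; rewrite (le_trans (ltW (truncnS_gt A)))// ler_nat.
by near: n; exact: nbhs_infty_ge.
Unshelve. all: by end_near. Qed.

Lemma cvg_harmonicV : (fun n : nat => n.+1%:R^-1 : R) @ \oo --> 0.
Proof. exact: cvg_harmonic. Qed.

Lemma nonincreasing_harmonic : nonincreasing_seq (fun n : nat => n.+1%:R^-1 : R).
Proof. by move=> m n mn; rewrite /= lef_pV2 ?posrE// ler_nat. Qed.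

Lemma nondecreasing_succr : nondecreasing_seq (fun n : nat => n.+1%:R : R).
Proof. by move=> m n mn; rewrite /= ler_nat. Qed.

Lemma halfline_cvg_integral_succ (f : R -> \bar R) :
  measurable_fun Rpos f -> (forall x, 0 < x -> (0 <= f x)%E) ->
  (\int[lmu]_(x in Icc n.+1%:R^-1 n.+1%:R) f x)%E @[n --> \oo] -->
  (\int[lmu]_(x in Rpos) f x)%E.
Proof.
move=> mf f0; apply: halfline_cvg_integral => //.
- exact: cvg_harmonic.
- exact: cvg_succr.
- exact: nonincreasing_harmonic.
- exact: nondecreasing_succr.
Qed.

Lemma harmonic_le_succ (n : nat) : (n.+1%:R^-1 : R) <= n.+1%:R.
Proof. by rewrite (@le_trans _ _ 1)// ?invf_le1 ?ler1n. Qed.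

(** The substitution rule holds on [[1/(n+1), n+1]]; these intervals and their images under [F] both
    exhaust the half-line, so the two sides are limits of the same sequence. Staying in the extended
    reals lets the lemma also transport integrability when applied to a norm. *)
Lemma halfline_substitution F G :
  (forall x, 0 < x -> derivable F x 1) ->
  (forall x, 0 < x -> {for x, continuous (derive1 F)}) ->
  (forall x, 0 < x -> 0 <= derive1 F x) ->
  (forall x y, 0 < x -> x < y -> F x < F y) ->
  (forall x, 0 < x -> 0 < F x) ->
  F n.+1%:R^-1 @[n --> \oo] --> 0 -> F n.+1%:R @[n --> \oo] --> +oo ->
  (forall x, 0 < x -> {for x, continuous G}) ->
  (forall x, 0 < x -> 0 <= G x) ->
  (\int[lmu]_(x in Rpos) (G x)%:E =
   \int[lmu]_(x in Rpos) (G (F x) * derive1 F x)%:E)%E.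
Proof.
move=> dF cF' F'0 iF F0 Fl Fr cG G0.
have cF x : 0 < x -> {for x, continuous F}.
  by move=> x0; apply: differentiable_continuous; apply/derivable1_diffP/dF.
have miF x y : 0 < x -> x <= y -> F x <= F y.
  by move=> x0; rewrite le_eqVlt => /predU1P[->//|xy]; exact/ltW/iF.
have A1 : (\int[lmu]_(x in Icc (F n.+1%:R^-1) (F n.+1%:R)) (G x)%:E)%E @[n --> \oo]
    --> (\int[lmu]_(x in Rpos) (G x)%:E)%E.
  apply: halfline_cvg_integral => //.
  - by move=> n; apply: F0; rewrite invr_gt0.
  - by move=> m n mn; apply: miF; rewrite ?invr_gt0//; exact: nonincreasing_harmonic.
  - by move=> m n mn; apply: miF; rewrite // ler_nat.
  - by apply/measurable_EFinP; exact: halfline_continuous_measurable.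
have cGF x : 0 < x -> {for x, continuous (fun x => G (F x) * derive1 F x)}.
  move=> x0; apply: cvgM; last exact: cF'.
  by apply: (@cvg_comp _ _ _ F G _ (nbhs (F x))); [exact: cF|exact/cG/F0].
have A2 : (\int[lmu]_(x in Icc n.+1%:R^-1 n.+1%:R) (G (F x) * derive1 F x)%:E)%E @[n --> \oo]
    --> (\int[lmu]_(x in Rpos) (G (F x) * derive1 F x)%:E)%E.
  apply: halfline_cvg_integral_succ => //.
  - by apply/measurable_EFinP; exact: halfline_continuous_measurable.
  - by move=> x x0; rewrite lee_fin mulr_ge0// ?F'0 ?G0 ?F0.
apply: (cvg_unique _ A1); first exact: ereal_hausdorff.
rewrite /= (eq_cvg _ _ (_ : _ =1 fun n =>
  (\int[lmu]_(x in Icc n.+1%:R^-1 n.+1%:R) (G (F x) * derive1 F x)%:E)%E))//= => n.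
have n0 : 0 < n.+1%:R^-1 :> R by rewrite invr_gt0.
apply/integration_by_substitution_increasing.
- exact: harmonic_le_succ.
- move=> x y; rewrite !in_itv/= => /andP[h _] _; apply: iF.
  exact: lt_le_trans h.
- by move=> x; rewrite in_itv/= => /andP[h _]; apply: cF'; exact: lt_trans h.
- by apply/cvg_ex; eexists; apply: cvg_at_right_filter; exact: cF'.
- by apply/cvg_ex; eexists; apply: cvg_at_left_filter; exact: cF'.
- split.
  + by move=> x; rewrite in_itv/= => /andP[h _]; apply: dF; exact: lt_trans h.
  + by apply: cvg_at_right_filter; exact: cF.
  + by apply: cvg_at_left_filter; exact: cF.
- apply: continuous_in_subspaceT => x; rewrite inE/= in_itv/= => /andP[h _].
  by apply: cG; apply: lt_le_trans h; exact: F0.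
Qed.

(** The intervals [[1/(n+1), n+1]] are stable under inversion, so a single exhaustion serves both
    sides. *)
Lemma halfline_substitution_inv G :
  (forall x, 0 < x -> {for x, continuous G}) ->
  (forall x, 0 < x -> 0 <= G x) ->
  (\int[lmu]_(x in Rpos) (G x)%:E =
   \int[lmu]_(x in Rpos) (G x^-1 * x ^- 2)%:E)%E.
Proof.
move=> cG G0.
have dV x : 0 < x -> is_derive x 1 (fun y : R => y^-1) (- x ^- 2).
  move=> x0; have xn : x != 0 by rewrite gt_eqF.
  have := @is_deriveV _ id x 1 1 xn (is_derive_id x 1).
  by rewrite /GRing.scale/= mulr1.
have dV1 x : 0 < x -> derive1 (fun y : R => y^-1) x = - x ^- 2.
  by move=> x0; rewrite derive1E; have [_ ->] := dV _ x0.
have cV x : 0 < x -> {for x, continuous (fun y : R => y^-1)}.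
  by move=> x0; apply: cvgV => //; rewrite gt_eqF.
have cV2 x : 0 < x -> {for x, continuous (fun y : R => y ^- 2)}.
  move=> x0; apply: cvgV; first by rewrite expf_neq0// gt_eqF.
  exact: exprn_continuous.
have cV' x : 0 < x -> {for x, continuous (derive1 (fun y : R => y^-1))}.
  move=> x0; rewrite /prop_for /continuous_at dV1//.
  apply: cvg_trans; last exact: (cvgN (cV2 _ x0)).
  apply: near_eq_cvg; near=> y; rewrite /= fctE -dV1//; near: y.
  exact: lt_nbhsr.
have A1 : (\int[lmu]_(x in Icc n.+1%:R^-1 n.+1%:R) (G x)%:E)%E @[n --> \oo]
    --> (\int[lmu]_(x in Rpos) (G x)%:E)%E.
  apply: halfline_cvg_integral_succ => //.
  - by apply/measurable_EFinP; exact: halfline_continuous_measurable.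
have A2 : (\int[lmu]_(x in Icc n.+1%:R^-1 n.+1%:R) (G x^-1 * x ^- 2)%:E)%E @[n --> \oo]
    --> (\int[lmu]_(x in Rpos) (G x^-1 * x ^- 2)%:E)%E.
  apply: halfline_cvg_integral_succ => //.
  - apply/measurable_EFinP; apply: halfline_continuous_measurable => x x0.
    apply: cvgM; last exact: cV2.
    apply: (@cvg_comp _ _ _ (fun y => y^-1) G _ (nbhs x^-1)); first exact: cV.
    by apply: cG; rewrite invr_gt0.
  - by move=> x x0; rewrite lee_fin mulr_ge0// ?G0 ?invr_gt0// invr_ge0 sqr_ge0.
apply: (cvg_unique _ A1); first exact: ereal_hausdorff.
rewrite /= (eq_cvg _ _ (_ : _ =1 fun n =>
  (\int[lmu]_(x in Icc n.+1%:R^-1 n.+1%:R) (G x^-1 * x ^- 2)%:E)%E))//= => n.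
have n0 : 0 < n.+1%:R^-1 :> R by rewrite invr_gt0.
transitivity (\int[lmu]_(x in Icc n.+1%:R^-1 n.+1%:R)
   (((G \o (fun y => y^-1)) * - derive1 (fun y : R => y^-1)) x)%:E)%E; last first.
    apply: eq_integral => x; rewrite inE/= in_itv/= => /andP[h _].
    congr EFin; rewrite fctE/=; congr (_ * _).
    by rewrite fctE dV1 ?opprK//; exact: lt_le_trans h.
(* The right end is written as the inverse of the left end, so that the interval reads as the image
   of itself under the decreasing map. *)
have E : Icc n.+1%:R^-1 n.+1%:R = Icc n.+1%:R^-1 (n.+1%:R^-1)^-1 by rewrite invrK.
rewrite [in LHS]E.
apply: (@integration_by_substitution_decreasing _ (fun y => y^-1)).
- exact: harmonic_le_succ.
- move=> x y; rewrite !in_itv/= => /andP[hx _] /andP[hy _] xy.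
  by rewrite ltf_pV2// posrE; [exact: lt_le_trans hx|exact: lt_le_trans hy].
- by move=> x; rewrite in_itv/= => /andP[h _]; apply: cV'; exact: lt_trans h.
- by apply/cvg_ex; eexists; apply: cvg_at_right_filter; exact: cV'.
- by apply/cvg_ex; eexists; apply: cvg_at_left_filter; exact: cV'.
- split.
  + move=> x; rewrite in_itv/= => /andP[h _].
    by have [] := dV x (lt_trans n0 h).
  + by apply: cvg_at_right_filter; exact: cV.
  + by apply: cvg_at_left_filter; exact: cV.
- apply: continuous_in_subspaceT => x; rewrite inE/= in_itv/= => /andP[h _].
  by apply: cG; apply: lt_le_trans h; rewrite ?invrK.
Unshelve. all: by end_near. Qed.

End HalfLine.

(** * Integrability by comparison with powers, and Gamma integrals *)

Section GammaFunction.
Context {R : realType}.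
Implicit Types (f F G : R -> R) (a b p s t x y : R).
Local Notation Rpos := (`]0, +oo[%classic : set R).
Local Notation Icc a b := ([set` Interval (BLeft a%R) (BRight b%R)] : set R).
Local Notation lmu := (@lebesgue_measure R).

(* The derivative of the bounded function [- (1 + x^p)^-1], comparable to
   [x^(p-1)] near 0 and to [x^(-p-1)] near infinity. *)
Definition powRbump p x := p * x `^ (p - 1) / (1 + x `^ p) ^+ 2.

Lemma powRbump_ge0 p x : 0 < p -> 0 <= powRbump p x.
Proof. by move=> p0; rewrite /powRbump divr_ge0 ?sqr_ge0// mulr_ge0 ?powR_ge0// ltW. Qed.

Lemma is_derive_powRbump p x : 0 < x ->
  is_derive x 1 (fun y => - (1 + y `^ p)^-1) (powRbump p x).
Proof.
move=> x0.
have n0 : 1 + x `^ p != 0 by rewrite gt_eqF// ltr_pwDl// powR_ge0.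
have d1 : is_derive x 1 (fun y => 1 + y `^ p) (p * x `^ (p - 1)).
  by rewrite -[X in is_derive _ _ _ X]add0r; apply: is_deriveD_fun; exact: is_derive1_powR.
have d2 := is_deriveN (@is_deriveV _ (fun y => 1 + y `^ p) _ _ _ n0 d1).
apply: (is_derive_eq d2).
by rewrite /powRbump /GRing.scale/= mulNr opprK mulrC.
Qed.

Lemma continuous_powRbump p x : 0 < x -> {for x, continuous (powRbump p)}.
Proof.
move=> x0; apply: cvgM.
  by apply: cvgM; [exact: cvg_cst|exact: continuous_powR].
apply: cvgV; first by rewrite expf_neq0// gt_eqF// ltr_pwDl// powR_ge0.
apply: (@cvg_comp _ _ _ (fun y => 1 + y `^ p) (fun z => z ^+ 2) _ (nbhs (1 + x `^ p))).
  by apply: cvgD; [exact: cvg_cst|exact: continuous_powR].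
exact: exprn_continuous.
Qed.

(** The primitive takes its values in [[-1, 0]], so the integral over any compact interval is at
    most 1. *)
Lemma integrable_powRbump p : 0 < p -> lmu.-integrable Rpos (EFin \o powRbump p).
Proof.
move=> p0; apply/integrableP; split.
  by apply/measurable_EFinP; apply: halfline_continuous_measurable => x; exact: continuous_powRbump.
apply: (@le_lt_trans _ _ 1%E); last exact: ltry.
under eq_integral do rewrite /= ger0_norm ?powRbump_ge0//.
have A : (\int[lmu]_(x in Icc n.+1%:R^-1 n.+1%:R) (powRbump p x)%:E)%E @[n --> \oo]
    --> (\int[lmu]_(x in Rpos) (powRbump p x)%:E)%E.
  apply: halfline_cvg_integral_succ => //.
  - by apply/measurable_EFinP; apply: halfline_continuous_measurable => x; exact: continuous_powRbump.
  - by move=> x x0; rewrite lee_fin powRbump_ge0.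
rewrite -(cvg_lim _ A)//; apply: lime_le; first by apply/cvg_ex; eexists; exact: A.
apply: nearW => n.
(* For [n = 0] the interval is the point 1, whereas the fundamental theorem needs distinct ends. *)
have [->|nn] := eqVneq n 0; first by rewrite invr1 set_itv1 integral_set1.
have n0 : 0 < n.+1%:R^-1 :> R by rewrite invr_gt0.
rewrite (@continuous_FTC2 _ _ (fun y => - (1 + y `^ p)^-1)).
- rewrite -EFinB lee_fin opprK addrC -[leRHS]subr0.
  apply: lerB; last by rewrite invr_ge0 addr_ge0// powR_ge0.
  by rewrite invf_le1 ?ltr_pwDl ?powR_ge0// lerDl powR_ge0.
- by rewrite (@lt_trans _ _ 1)// ?invf_lt1 ?ltr1n// ltnS lt0n.
- apply: continuous_in_subspaceT => x; rewrite inE/= in_itv/= => /andP[h _].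
  by apply: continuous_powRbump; exact: lt_le_trans h.
- have cc x : 0 < x -> {for x, continuous (fun y => - (1 + y `^ p)^-1)}.
    by move=> x0; apply: is_derive_continuous; exact: is_derive_powRbump.
  split.
  + move=> x; rewrite in_itv/= => /andP[h _].
    by have [] := is_derive_powRbump p (lt_trans n0 h).
  + by apply: cvg_at_right_filter; exact: cc.
  + by apply: cvg_at_left_filter; exact: cc.
- move=> x; rewrite in_itv/= => /andP[h _]; rewrite derive1E.
  by have [_ ->] := is_derive_powRbump p (lt_trans n0 h).
Qed.

Lemma powR_le_bump p x (X : R) : 0 < p -> 0 < x -> x <= X ->
  x `^ (p - 1) <= (1 + X `^ p) ^+ 2 / p * powRbump p x.
Proof.
move=> p0 x0 xX; have d0 : 0 < 1 + x `^ p by rewrite ltr_pwDl// powR_ge0.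
rewrite [leRHS](_ : _ = x `^ (p - 1) * ((1 + X `^ p) ^+ 2 / (1 + x `^ p) ^+ 2)); last first.
  by rewrite /powRbump; field; rewrite !gt_eqF.
rewrite ler_peMr ?powR_ge0// ler_pdivlMr ?exprn_gt0// mul1r.
rewrite ler_sqr ?nnegrE ?addr_ge0 ?powR_ge0// lerD2l.
by rewrite ge0_ler_powR ?nnegrE// ltW// (lt_le_trans x0).
Qed.

(** For [x >= 1] the denominator satisfies [1 + x^p <= 2 x^p]; squaring gives the factor 4. *)
Lemma powR_ge_bump p x : 0 < p -> 1 <= x ->
  x `^ (- p - 1) <= 4 / p * powRbump p x.
Proof.
move=> p0 x1; have x0 : 0 < x by exact: lt_le_trans x1.
have d0 : 0 < 1 + x `^ p by rewrite ltr_pwDl// powR_ge0.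
have e1 : x `^ (p - 1) = x `^ (- p - 1) * (x `^ p) ^+ 2.
  rewrite expr2 -!powRDpos//; congr (_ `^ _); ring.
rewrite [leRHS](_ : _ = x `^ (- p - 1) * ((2 * x `^ p) ^+ 2 / (1 + x `^ p) ^+ 2)); last first.
  by rewrite /powRbump e1; field; rewrite !gt_eqF.
rewrite ler_peMr ?powR_ge0// ler_pdivlMr ?exprn_gt0// mul1r.
rewrite ler_sqr ?nnegrE ?addr_ge0 ?mulr_ge0 ?powR_ge0//.
by rewrite mulrDl mul1r lerD2r -(powRr0 x) ler_powR// ltW.
Qed.

(** The dominating function is a sum of two bumps, of exponent [a + 1] to control 0 and [b - 1] to
    control infinity. *)
Lemma halfline_integrable_dom f a b (C : R) : -1 < a -> 1 < b ->
  measurable_fun Rpos f ->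
  (forall x, 0 < x -> x <= 1 -> `|f x| <= C * x `^ a) ->
  (forall x, 1 <= x -> `|f x| <= C * x `^ (- b)) ->
  lmu.-integrable Rpos (EFin \o f).
Proof.
move=> a1 b1 mf fa fb.
have p0 : 0 < a + 1 by lra.
have q0 : 0 < b - 1 by lra.
(* The sign of [C] is read off the second bound at [x = 1]. *)
have C0 : 0 <= C.
  by have := fb 1 (lexx _); rewrite powR1 mulr1; exact: le_trans.
pose k1 := C * ((1 + 1 `^ (a + 1)) ^+ 2 / (a + 1)); pose k2 := C * (4 / (b - 1)).
have k10 : 0 <= k1.
  by rewrite /k1 mulr_ge0// divr_ge0 ?sqr_ge0// ltW.
have kb1 x : 0 <= k1 * powRbump (a + 1) x by apply: mulr_ge0 => //; exact: powRbump_ge0.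
have k20 : 0 <= k2 by rewrite /k2 mulr_ge0// divr_ge0// ltW.
have kb2 x : 0 <= k2 * powRbump (b - 1) x by apply: mulr_ge0 => //; exact: powRbump_ge0.
apply: (@le_integrableR _ _ _ lmu _ _ _
  (fun x => k1 * powRbump (a + 1) x + k2 * powRbump (b - 1) x)) => //.
- move=> x /=; rewrite in_itv/= andbT => x0.
  have [x1|x1] := leP x 1.
  + rewrite (le_trans (fa _ x0 x1))// ler_wpDr//.
    by rewrite /k1 -mulrA ler_wpM2l//; have := powR_le_bump p0 x0 x1; rewrite addrK.
  + rewrite (le_trans (fb _ (ltW x1)))// ler_wpDl//.
    have := powR_ge_bump q0 (ltW x1); rewrite (_ : - (b - 1) - 1 = - b); last by ring.
    by move=> h; rewrite /k2 -mulrA ler_wpM2l.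
- by apply: integrableZD => //; exact: integrable_powRbump.
Qed.

Lemma integrable_powR_left a (X : R) : -1 < a ->
  lmu.-integrable (`]0, X[%classic : set R) (EFin \o (fun x => x `^ a)).
Proof.
move=> a1; have p0 : 0 < a + 1 by lra.
have sub : `]0, X[%classic `<=` Rpos.
  by move=> x/=; rewrite !in_itv/= andbT => /andP[].
pose k := (1 + X `^ (a + 1)) ^+ 2 / (a + 1).
apply: (@le_integrableR _ _ _ lmu _ _ _
  (fun x => k * powRbump (a + 1) x + 0 * powRbump (a + 1) x)) => //.
- by apply: (@measurable_funS _ _ _ _ Rpos) => //; apply: halfline_continuous_measurable => x; exact: continuous_powR.
- move=> x /=; rewrite in_itv/= => /andP[x0 xX].
  rewrite mul0r addr0 ger0_norm ?powR_ge0//.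
  by have := powR_le_bump p0 x0 (ltW xX); rewrite addrK.
- have I : lmu.-integrable (`]0, X[%classic : set R) (EFin \o powRbump (a + 1)).
    by apply: (@integrableS _ _ _ lmu Rpos) => //; exact: integrable_powRbump.
  by apply: integrableZD => //; apply: I.
Qed.

(** The inequality [u <= exp u] at [u = t / s], raised to the power [s]. *)
Lemma expR_ge_powR s t : 0 < s -> 0 < t -> t `^ s <= s `^ s * expR t.
Proof.
move=> s0 t0; have -> : expR t = expR (t / s) `^ s.
  by rewrite -expRM mulfVK// gt_eqF.
rewrite -powRM ?expR_ge0 ?(ltW s0)// ge0_ler_powR ?nnegrE ?mulr_ge0 ?expR_ge0 ?(ltW s0) ?(ltW t0)//.
rewrite -ler_pdivrMl// mulrC.
by apply: le_trans (expR_ge1Dx _); rewrite lerDr.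
Qed.

Definition gamma_fun s t := t `^ (s - 1) * expR (- t).

Lemma gamma_fun_ge0 s t : 0 <= gamma_fun s t.
Proof. by rewrite mulr_ge0 ?powR_ge0 ?expR_ge0. Qed.

Lemma continuous_expRM a t : {for t, continuous (fun u => expR (a * u))}.
Proof.
apply: (@cvg_comp _ _ _ (fun u => a * u) expR _ (nbhs (a * t))); last exact: continuous_expR.
by apply: cvgM; [exact: cvg_cst|exact: cvg_id].
Qed.

Lemma continuous_powR_expR p a t : 0 < t ->
  {for t, continuous (fun u => u `^ p * expR (a * u))}.
Proof. by move=> t0; apply: cvgM; [exact: continuous_powR|exact: continuous_expRM]. Qed.

Lemma continuous_gamma_fun s t : 0 < t -> {for t, continuous (gamma_fun s)}.
Proof.
move=> t0; have := @continuous_powR_expR (s - 1) (-1) t t0.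
by under [X in {for _, continuous X}]eq_fun do rewrite mulN1r.
Qed.

(** The previous bound with exponent [s + 1]. It controls both the tail of the Gamma integrand and
    the boundary term at infinity in the functional equation. *)
Lemma gamma_fun_le s t : 0 < s -> 0 < t ->
  t `^ s * expR (- t) <= (s + 1) `^ (s + 1) * t^-1.
Proof.
move=> s0 t0; rewrite expRN ler_pdivrMr ?expR_gt0// mulrAC ler_pdivlMr//.
rewrite -[X in _ * X]powRr1 ?(ltW t0)// -powRDpos//.
by apply: expR_ge_powR => //; rewrite addr_gt0.
Qed.

Lemma integrable_gamma_fun s : 0 < s -> lmu.-integrable Rpos (EFin \o gamma_fun s).
Proof.
move=> s0; pose C := 1 + (s + 1) `^ (s + 1).
have C1 : 1 <= C by rewrite lerDl powR_ge0.
apply: (@halfline_integrable_dom _ (s - 1) 2 C); first lra; first lra.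
- by apply: halfline_continuous_measurable => x; exact: continuous_gamma_fun.
- move=> x x0 x1; rewrite ger0_norm ?gamma_fun_ge0// /gamma_fun mulrC.
  rewrite ler_wpM2r ?powR_ge0// (le_trans _ C1)//.
  by rewrite -expR0 ler_expR lerNl oppr0 ltW.
- move=> x x1; have x0 : 0 < x by exact: lt_le_trans x1.
  rewrite ger0_norm ?gamma_fun_ge0// /gamma_fun powRDpos// powR_inv1 ?(ltW x0)//.
  rewrite mulrAC ler_pdivrMr// (le_trans (gamma_fun_le s0 x0))//.
  rewrite -mulrA -[X in _ * (_ * X)]powRr1 ?(ltW x0)// -powRDpos//.
  rewrite (_ : -2 + 1 = -1); last lra.
  by rewrite powR_inv1 ?(ltW x0)// ler_wpM2r ?invr_ge0 ?(ltW x0)// /C lerDr.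
Qed.

Lemma GammaE s : 0 < s -> (\int[lmu]_(t in Rpos) (gamma_fun s t)%:E = (Gamma s)%:E)%E.
Proof.
move=> s0; rewrite /Gamma /Rintegral fineK//.
exact: integrable_fin_num (integrable_gamma_fun s0).
Qed.

(** On [[1, 2]] one has [t^(s-1) >= 1/t >= 1/2] and [exp (- t) >= exp (- 2)]. A bound independent of
    [s] suffices to dominate the Bessel series by an exponential series. *)
Lemma Gamma_lb s : 0 < s -> expR (-2) / 2 <= Gamma s.
Proof.
move=> s0; rewrite -lee_fin -GammaE//.
apply: (@le_trans _ _ (\int[lmu]_(t in Icc 1 2) (expR (-2) / 2)%:E)%E).
  rewrite integral_cst//= lebesgue_measure_itv/= lte_fin ltr1n -EFinD.
  by rewrite (_ : 2 - 1 = 1) ?mule1//; lra.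
apply: (@le_trans _ _ (\int[lmu]_(t in Icc 1 2) (gamma_fun s t)%:E)%E).
  apply: ge0_le_integral => //.
  - apply/measurable_EFinP; apply: (@measurable_funS _ _ _ _ Rpos) => //.
      by move=> x/=; rewrite !in_itv/= andbT => /andP[+ _]; apply: lt_le_trans.
    by apply: halfline_continuous_measurable => x; exact: continuous_gamma_fun.
  - move=> x/=; rewrite in_itv/= => /andP[x1 x2]; rewrite lee_fin /gamma_fun mulrC.
    have x0 : 0 < x by exact: lt_le_trans x1.
    apply: ler_pM; rewrite ?invr_ge0 ?expR_ge0 ?ler_expR ?lerN2//.
    apply: (@le_trans _ _ (x `^ (-1))).
      by rewrite powR_inv1 ?(ltW x0)// lef_pV2 ?posrE.
    by rewrite ler_powR//; lra.
apply: ge0_subset_integral => //.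
- apply/measurable_EFinP; apply: halfline_continuous_measurable => x; exact: continuous_gamma_fun.
- by move=> x _; rewrite lee_fin gamma_fun_ge0.
- by move=> x/=; rewrite !in_itv/= andbT => /andP[+ _]; apply: lt_le_trans.
Qed.

Lemma Gamma_gt0 s : 0 < s -> 0 < Gamma s.
Proof. by move=> /Gamma_lb; apply: lt_le_trans; rewrite divr_gt0// expR_gt0. Qed.

(** Integration by parts on compact intervals: [F] is the boundary term, and it vanishes at both
    ends of the half-line. *)
Lemma GammaS s : 0 < s -> Gamma (s + 1) = s * Gamma s.
Proof.
move=> s0.
pose F t := t `^ s * expR (- t).
have dF t : 0 < t -> is_derive t 1 F (s * gamma_fun s t - gamma_fun (s + 1) t).
  move=> t0; have dE := @is_derive_comp_fun _ expR -%R t _ _ (is_derive_expR _) (is_deriveNid t 1).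
  apply: (is_derive_eq (is_deriveM_fun (is_derive1_powR s t0) dE)).
  by rewrite /gamma_fun addrK; ring.
have cF t : 0 < t -> {for t, continuous F} by move=> /dF; exact: is_derive_continuous.
have I n f : 0 < n.+1%:R^-1 :> R -> (forall x, 0 < x -> {for x, continuous f}) ->
   lmu.-integrable (Icc n.+1%:R^-1 n.+1%:R) (EFin \o f).
  move=> n0 cf; apply: continuous_compact_integrable; first exact: segment_compact.
  apply: continuous_in_subspaceT => x; rewrite inE/= in_itv/= => /andP[h _].
  by apply: cf; exact: lt_le_trans h.
have cg u t : 0 < t -> {for t, continuous (gamma_fun u)} by exact: continuous_gamma_fun.
have csg t : 0 < t -> {for t, continuous (fun t => s * gamma_fun s t)}.
  by move=> t0; apply: cvgM; [exact: cvg_cst|exact: cg].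
have lim f : (forall x, 0 < x -> {for x, continuous f}) -> (forall x, 0 <= f x) ->
   (\int[lmu]_(x in Icc n.+1%:R^-1 n.+1%:R) (f x)%:E)%E @[n --> \oo] -->
   (\int[lmu]_(x in Rpos) (f x)%:E)%E.
  move=> cf f0; apply: halfline_cvg_integral_succ => //.
  - by apply/measurable_EFinP; exact: halfline_continuous_measurable.
  - by move=> x _; rewrite lee_fin.
have L1 := lim _ csg (fun x => mulr_ge0 (ltW s0) (gamma_fun_ge0 s x)).
have L2 := lim _ (cg (s + 1)) (gamma_fun_ge0 (s + 1)).
have Fr : F n.+1%:R @[n --> \oo] --> 0.
  apply: (@squeeze_cvgr _ _ _ _ (fun=> 0) (fun n => (s + 1) `^ (s + 1) * n.+1%:R^-1)).
  - apply: nearW => n; rewrite mulr_ge0 ?powR_ge0 ?expR_ge0//=.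
    exact: gamma_fun_le.
  - exact: cvg_cst.
  - rewrite -[X in _ --> X](mulr0 ((s + 1) `^ (s + 1))).
    by apply: cvgM; [exact: cvg_cst|exact: cvg_harmonicV].
have Fl : F n.+1%:R^-1 @[n --> \oo] --> 0.
  apply: (@squeeze_cvgr _ _ _ _ (fun=> 0) (fun n => n.+1%:R^-1 `^ s)).
  - apply: nearW => n; rewrite mulr_ge0 ?powR_ge0 ?expR_ge0//=.
    by rewrite ler_piMr ?powR_ge0// -expR0 ler_expR lerNl oppr0 invr_ge0.
  - exact: cvg_cst.
  (* The limit of [x^s] at 0 is one-sided, so the sequence must be seen to approach 0 through
     positive values. *)
  - apply: (cvg_comp (fun n : nat => n.+1%:R^-1 : R) (fun x => x `^ s)); last exact: powR_cvg0.
    move=> P hP; change (\forall n \near \oo, P (n.+1%:R^-1)).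
    have h : \forall n \near \oo, 0 < (n.+1%:R^-1 : R) -> P (n.+1%:R^-1).
      exact: (cvg_harmonicV hP).
    by apply: filterS h => n; apply; rewrite invr_gt0.
(* The index is shifted by one to avoid the degenerate interval [[1, 1]]; the limits are shifted
   accordingly below. *)
have E n : (\int[lmu]_(x in Icc n.+2%:R^-1 n.+2%:R) (s * gamma_fun s x)%:E -
            \int[lmu]_(x in Icc n.+2%:R^-1 n.+2%:R) (gamma_fun (s + 1) x)%:E =
            (F n.+2%:R)%:E - (F n.+2%:R^-1)%:E)%E.
  have n0 : 0 < n.+2%:R^-1 :> R by rewrite invr_gt0.
  have i1 := I n.+1 _ n0 csg; have i2 := I n.+1 _ n0 (cg (s + 1)).
  rewrite -integralB_EFin//.
  apply: continuous_FTC2.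
  - by rewrite (@lt_trans _ _ 1)// ?invf_lt1 ?ltr1n.
  - apply: continuous_in_subspaceT => x; rewrite inE/= in_itv/= => /andP[h _].
    have x0 := lt_le_trans n0 h.
    by apply: cvgB; [exact: csg|exact: cg].
  - split.
    + move=> x; rewrite in_itv/= => /andP[h _].
      by have [] := dF _ (lt_trans n0 h).
    + by apply: cvg_at_right_filter; exact: cF.
    + by apply: cvg_at_left_filter; exact: cF.
  - move=> x; rewrite in_itv/= => /andP[h _]; rewrite derive1E.
    by have [_ ->] := dF _ (lt_trans n0 h).
have Es : (\int[lmu]_(x in Rpos) (s * gamma_fun s x)%:E = (s * Gamma s)%:E)%E.
  under eq_integral do rewrite EFinM.
  rewrite integralZl//; last exact: integrable_gamma_fun.
  by rewrite GammaE// -EFinM.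
have s1 : 0 < s + 1 by rewrite addr_gt0.
rewrite Es in L1; rewrite GammaE// in L2.
have D : ((s * Gamma s)%:E +? - (Gamma (s + 1))%:E)%E by [].
have A := cvgeB D L1 L2.
have B : ((F n.+2%:R)%:E - (F n.+2%:R^-1)%:E)%E @[n --> \oo] --> (0 - 0 : R)%:E.
  apply: cvg_EFin; first by apply: nearW.
  rewrite /=; apply: cvgB.
    by rewrite (cvg_shiftS (fun n => F n.+1%:R)).
  by rewrite (cvg_shiftS (fun n => F n.+1%:R^-1)).
rewrite subrr in B.
have C : ((F n.+2%:R)%:E - (F n.+2%:R^-1)%:E)%E @[n --> \oo] -->
    ((s * Gamma s)%:E - (Gamma (s + 1))%:E)%E.
  rewrite (eq_cvg _ _ (fun n => esym (E n))).
  by have := A eventually_filter; rewrite -cvg_shiftS.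
have E0 : (0%:E = (s * Gamma s)%:E - (Gamma (s + 1))%:E)%E.
  exact: (cvg_unique (@ereal_hausdorff R) B C).
have /esym/eqP := congr1 (@fine R) E0; by rewrite /= subr_eq0 => /eqP ->.
Qed.

Lemma halfline_scale G a : 0 < a ->
  (forall x, 0 < x -> {for x, continuous G}) -> (forall x, 0 < x -> 0 <= G x) ->
  (\int[lmu]_(x in Rpos) (G x)%:E = \int[lmu]_(x in Rpos) (a * G (a * x))%:E)%E.
Proof.
move=> a0 cG G0.
have dF x : is_derive x 1 (fun y => a * y) a.
  apply: (is_derive_eq (is_deriveM_fun (is_derive_cst a x 1) (is_derive_id x 1))).
  by rewrite mul0r add0r mulr1.
have dE : derive1 (fun y => a * y) = cst a.
  by apply/funext => x; rewrite derive1E; have [_ ->] := dF x.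
rewrite (@halfline_substitution _ (fun y => a * y))//.
- by apply: eq_integral => x _; rewrite dE mulrC.
- by move=> x _; rewrite dE; exact: cvg_cst.
- by move=> x _; rewrite dE ltW.
- by move=> x y _ xy; rewrite ltr_pM2l.
- by move=> x x0; rewrite mulr_gt0.
- rewrite -[X in _ --> X](mulr0 a).
  by apply: cvgM; [exact: cvg_cst|exact: cvg_harmonicV].
- apply: (cvg_comp (fun n : nat => n.+1%:R : R) (fun x => a * x)); first exact: cvg_succr.
  by apply: (gt0_cvgMry a0); exact: cvg_id.
Qed.

Lemma halfline_square G :
  (forall x, 0 < x -> {for x, continuous G}) -> (forall x, 0 < x -> 0 <= G x) ->
  (\int[lmu]_(x in Rpos) (G x)%:E = \int[lmu]_(x in Rpos) (G (x ^+ 2) * (2 * x))%:E)%E.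
Proof.
move=> cG G0.
have dF := @is_derive_sqr R.
have dE : derive1 (fun y : R => y ^+ 2) = (fun x => 2 * x).
  by apply/funext => x; rewrite derive1E; have [_ ->] := dF x.
rewrite (@halfline_substitution _ (fun y => y ^+ 2))//.
- by apply: eq_integral => x _; rewrite dE.
- by move=> x _; rewrite dE; apply: cvgM; [exact: cvg_cst|exact: cvg_id].
- by move=> x x0; rewrite dE mulr_ge0// ltW.
- by move=> x y x0 xy; rewrite ltr_sqr ?nnegrE// ltW// (lt_trans x0).
- by move=> x x0; rewrite exprn_gt0.
- rewrite -[X in _ --> X](mulr0 0); under eq_cvg do rewrite expr2.
  by apply: cvgM; exact: cvg_harmonicV.
- apply: (cvg_comp (fun n : nat => n.+1%:R : R) (fun z => z ^+ 2)); first exact: cvg_succr.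
  exact: cvgr_expr2.
Qed.

Lemma Gamma_scale s a : 0 < s -> 0 < a ->
  (\int[lmu]_(t in Rpos) (t `^ (s - 1) * expR (- (a * t)))%:E = (Gamma s * a `^ (- s))%:E)%E.
Proof.
move=> s0 a0.
have E : ((Gamma s)%:E = (a `^ s)%:E *
    \int[lmu]_(t in Rpos) (t `^ (s - 1) * expR (- (a * t)))%:E)%E.
  rewrite -GammaE// (@halfline_scale _ a)//; last 2 first.
  - by move=> x; exact: continuous_gamma_fun.
  - by move=> x _; exact: gamma_fun_ge0.
  rewrite -ge0_integralZl; last 4 first.
  - exact: measurable_itv.
  - apply/measurable_EFinP; apply: halfline_continuous_measurable => x x0.
    have := @continuous_powR_expR (s - 1) (- a) x x0.
    by under [X in {for _, continuous X}]eq_fun do rewrite mulNr.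
  - by move=> x _; rewrite lee_fin mulr_ge0 ?powR_ge0 ?expR_ge0.
  - by rewrite lee_fin powR_ge0.
  apply: eq_integral => x; rewrite inE/= in_itv/= andbT => x0; rewrite -EFinM; congr EFin.
  rewrite /gamma_fun powRM ?ltW// !mulrA; congr (_ * _ * _).
  by rewrite -[X in X * _]powRr1 ?ltW// -powRDpos// addrC subrK.
by rewrite EFinM E muleAC -EFinM -powRDpos// subrr powRr0 mul1e.
Qed.

Lemma Gamma_sqr s a : 0 < s -> 0 < a ->
  (\int[lmu]_(y in Rpos) (y `^ (2 * s - 1) * expR (- (a * y ^+ 2)))%:E =
   (Gamma s * a `^ (- s) / 2)%:E)%E.
Proof.
move=> s0 a0.
have E : (\int[lmu]_(t in Rpos) (t `^ (s - 1) * expR (- (a * t)))%:E)%E =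
   (2%:E * \int[lmu]_(y in Rpos) (y `^ (2 * s - 1) * expR (- (a * y ^+ 2)))%:E)%E.
  rewrite halfline_square; last 2 first.
  - move=> x x0; have := @continuous_powR_expR (s - 1) (- a) x x0.
    by under [X in {for _, continuous X}]eq_fun do rewrite mulNr.
  - by move=> x _; rewrite mulr_ge0 ?powR_ge0 ?expR_ge0.
  rewrite -ge0_integralZl; last 4 first.
  - exact: measurable_itv.
  - apply/measurable_EFinP; apply: halfline_continuous_measurable => x x0.
    apply: cvgM; first exact: continuous_powR.
    apply: (@cvg_comp _ _ _ (fun y => - (a * y ^+ 2)) expR _ (nbhs (- (a * x ^+ 2)))).
      by apply: cvgN; apply: cvgM; [exact: cvg_cst|exact: exprn_continuous].
    exact: continuous_expR.
  - by move=> x _; rewrite lee_fin mulr_ge0 ?powR_ge0 ?expR_ge0.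
  - by rewrite lee_fin.
  apply: eq_integral => x; rewrite inE/= in_itv/= andbT => x0; rewrite -EFinM; congr EFin.
  have -> : (x ^+ 2) `^ (s - 1) = x `^ (2 * s - 2).
    by rewrite -powR_mulrn ?ltW// -powRrM; congr (_ `^ _); ring.
  have -> : x `^ (2 * s - 1) = x `^ (2 * s - 2) * x.
    by rewrite -{3}(powRr1 (ltW x0)) -powRDpos//; congr (_ `^ _); ring.
  ring.
move: E; rewrite Gamma_scale// => E.
by rewrite EFinM E muleAC -EFinM mulfV// mul1e.
Qed.

(** This is the shape left for the outer integral once Weber's integral has produced the factor
    [exp (- 1/(4 t))]. *)
Lemma Gamma_inv p a : 0 < p -> 0 < a ->
  (\int[lmu]_(t in Rpos) (t `^ (- p - 1) * expR (- (a / t)))%:E = (Gamma p * a `^ (- p))%:E)%E.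
Proof.
move=> p0 a0; rewrite -Gamma_scale; [|exact: p0|exact: a0].
rewrite [RHS]halfline_substitution_inv; last 2 first.
- move=> x x0; have := @continuous_powR_expR (p - 1) (- a) x x0.
  by under [X in {for _, continuous X}]eq_fun do rewrite mulNr.
- by move=> x _; rewrite mulr_ge0 ?powR_ge0 ?expR_ge0.
apply: eq_integral => x; rewrite inE/= in_itv/= andbT => x0; congr EFin.
rewrite mulrAC; congr (_ * _).
rewrite -powR_inv1 ?ltW// -powRrM -powR_invn ?ltW// -powRDpos//.
by congr (_ `^ _); ring.
Qed.

End GammaFunction.

(** A coefficient recurrence passes to partial sums. Multiplication by [z] raises degrees by one, so
    the sum of [b2] stops one term earlier; the first hypothesis matches the constant terms. *)
Lemma three_term_series {R : realType} (b0 b1 b2 : nat -> R) (m z : R) :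
  m * b1 0%N = b0 0%N ->
  (forall k, z * (b2 k * z ^+ k) - m * (b1 k.+1 * z ^+ k.+1) + b0 k.+1 * z ^+ k.+1 = 0) ->
  forall n, z * pseries b2 z n - m * pseries b1 z n.+1 + pseries b0 z n.+1 = 0.
Proof.
move=> base step.
have S c k : pseries c z k.+1 = pseries c z k + c k * z ^+ k.
  by rewrite /pseries /series/= big_nat_recr.
have Z c : pseries c z 0%N = 0 by rewrite /pseries /series/= big_geq.
elim => [|n].
  by rewrite (S b1) (S b0) (Z b0) (Z b1) (Z b2) expr0 !add0r mulr0 !mulr1 base sub0r addNr.
rewrite (S b2) (S b1 n.+1) (S b0 n.+1).
move: (step n); move: (pseries b2 z n) (pseries b1 z n.+1) (pseries b0 z n.+1).
move: (b2 n * _) (b1 n.+1 * _) (b0 n.+1 * _).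
by move=> x1 x2 x3 x4 x5 x6 h1 h2; rewrite -(addr0 0) -{1}h2 -h1; ring.
Qed.

(** * The entire factor of the Bessel function, its differential equation and bounds *)

Section BesselEntire.
Context {R : realType}.
Implicit Types (mu x y z : R) (k n : nat).

Definition besselc mu k : R := (-1) ^+ k / (k`!%:R * Gamma (mu + k%:R + 1)).

(* J_mu y = (y / 2)^mu * besselE mu (y^2 / 4) *)
Definition besselE mu z : R := limn (pseries (besselc mu) z).

Let gamma_lb : R := expR (-2) / 2.

Let gamma_lb_gt0 : 0 < gamma_lb. Proof. by rewrite divr_gt0// expR_gt0. Qed.

Lemma besselc_arg_gt0 mu k : -1 < mu -> 0 < mu + k%:R + 1.
Proof. by move=> mu1; have := ler0n R k; lra. Qed.

Lemma besselc_bound mu k : -1 < mu -> `|besselc mu k| <= gamma_lb^-1 * (k`!%:R)^-1.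
Proof.
move=> mu1; have G0 := Gamma_gt0 (besselc_arg_gt0 k mu1).
have k0 : 0 < k`!%:R :> R by rewrite ltr0n fact_gt0.
rewrite normrM normrX normrN1 expr1n mul1r normfV normrM !gtr0_norm//.
rewrite invfM mulrC ler_wpM2r// ?invr_ge0 ?ler0n//.
by rewrite lef_pV2 ?posrE//; exact/Gamma_lb/besselc_arg_gt0.
Qed.

Lemma besselc_term_bound mu k z : -1 < mu ->
  `|besselc mu k * z ^+ k| <= gamma_lb^-1 * exp_coeff `|z| k.
Proof.
move=> mu1; rewrite normrM normrX /exp_coeff/= [_ ^+ k / _]mulrC mulrA.
by rewrite ler_wpM2r ?exprn_ge0// besselc_bound.
Qed.

Let cvg_exp (r : R) z : cvgn (series (fun k => r * exp_coeff z k)).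
Proof.
rewrite (_ : (fun k => r * exp_coeff z k) = r *: exp_coeff z)//.
by apply: is_cvg_seriesZ; exact: is_cvg_series_exp_coeff.
Qed.

Lemma is_cvg_besselE_norm mu z : -1 < mu ->
  cvgn [normed series (fun k => besselc mu k * z ^+ k)].
Proof.
move=> mu1; apply: (@series_le_cvg _ _ (fun k => gamma_lb^-1 * exp_coeff `|z| k)).
- by move=> n; exact: normr_ge0.
- move=> n; rewrite mulr_ge0 ?invr_ge0 ?(ltW gamma_lb_gt0)// /exp_coeff/=.
  by rewrite divr_ge0 ?exprn_ge0.
- by move=> n; exact: besselc_term_bound.
- exact: cvg_exp.
Qed.

Lemma is_cvg_besselE mu z : -1 < mu -> cvgn (pseries (besselc mu) z).
Proof. by move=> mu1; apply: normed_cvg; exact: is_cvg_besselE_norm. Qed.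

Lemma besselE_bound mu z : -1 < mu -> `|besselE mu z| <= gamma_lb^-1 * expR `|z|.
Proof.
move=> mu1; rewrite /besselE /pseries; have h := lim_series_norm (@is_cvg_besselE_norm mu z mu1).
apply: (le_trans h).
have -> : gamma_lb^-1 * expR `|z| = limn (series (fun k => gamma_lb^-1 * exp_coeff `|z| k)).
  rewrite (_ : (fun k => _) = gamma_lb^-1 *: exp_coeff `|z|)//.
  by rewrite lim_seriesZ//; exact: is_cvg_series_exp_coeff.
apply: lim_series_le.
- exact: is_cvg_besselE_norm.
- exact: cvg_exp.
- by move=> n; exact: besselc_term_bound.
Qed.

(** The factor [k + 1] cancels in [(k + 1)!], and the shift of [k] inside Gamma becomes a shift of
    the order. Hence differentiation raises the order by one and changes the sign. *)
Lemma pseries_diffs_besselc mu :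
  pseries_diffs (besselc mu) = (fun k => - besselc (mu + 1) k).
Proof.
apply/funext => k; rewrite /pseries_diffs /besselc exprS mulN1r factS natrM.
have -> : mu + k.+1%:R + 1 = mu + 1 + k%:R + 1 by rewrite -(natr1 k); ring.
rewrite mulNr mulrN -[k.+1%:R * _ * _]mulrA [(k.+1%:R * _)^-1]invfM.
by rewrite [(-1) ^+ k * (_ * _)]mulrCA mulVKf// pnatr_eq0.
Qed.

Lemma is_derive_besselE mu z : -1 < mu ->
  is_derive z 1 (besselE mu) (- besselE (mu + 1) z).
Proof.
move=> mu1; have mu2 : -1 < mu + 1 by lra.
have mu3 : -1 < mu + 1 + 1 by lra.
have N m y : pseries (fun k => - besselc m k) y = - pseries (besselc m) y.
  by rewrite /pseries -seriesN; congr series; apply/funext => k; exact: mulNr.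
have -> : - besselE (mu + 1) z = limn (pseries (pseries_diffs (besselc mu)) z).
  rewrite pseries_diffs_besselc N limN//.
  exact: is_cvg_besselE.
(* Termwise differentiation asks that the series and its first two formal derivatives converge at a
   point beyond [|z|]. *)
apply: (@pseries_snd_diffs _ _ (`|z| + 1)).
- exact: is_cvg_besselE.
- by rewrite pseries_diffs_besselc N; apply: is_cvgN; exact: is_cvg_besselE.
- rewrite pseries_diffs_besselc pseries_diffsN pseries_diffs_besselc.
  by rewrite -[X in pseries X]/(- (fun k => - besselc (mu + 1 + 1) k)) opprK; exact: is_cvg_besselE.
- by rewrite [ltRHS]ger0_norm ?addr_ge0// ltrDl.
Qed.

(** This is the equation [z E'' + (mu + 1) E' + E = 0], with derivatives expressed by higher orders.
    On coefficients it reduces to the functional equation of Gamma. *)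
Lemma besselE_ode mu z : -1 < mu ->
  z * besselE (mu + 1 + 1) z - (mu + 1) * besselE (mu + 1) z + besselE mu z = 0.
Proof.
move=> mu1; have mu2 : -1 < mu + 1 by lra.
have mu3 : -1 < mu + 1 + 1 by lra.
have step k : z * (besselc (mu + 1 + 1) k * z ^+ k)
    - (mu + 1) * (besselc (mu + 1) k.+1 * z ^+ k.+1)
    + besselc mu k.+1 * z ^+ k.+1 = 0.
  have e0 : mu + k.+1%:R + 1 = mu + k%:R + 2 by rewrite -(natr1 k); ring.
  have e1 : mu + 1 + k.+1%:R + 1 = (mu + k%:R + 2) + 1 by rewrite -(natr1 k); ring.
  have e2 : mu + 1 + 1 + k%:R + 1 = (mu + k%:R + 2) + 1 by ring.
  have p0 : 0 < mu + k%:R + 2 by have := ler0n R k; lra.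
  rewrite /besselc e0 e1 e2 GammaS// factS natrM !exprS -(natr1 k).
  have G0 := Gamma_gt0 p0.
  have k0 : 0 < k`!%:R :> R by rewrite ltr0n fact_gt0.
  have k1 : 0 < k%:R + 1 :> R by rewrite ltr_wpDl.
  by field; rewrite !gt_eqF.
have base : (mu + 1) * besselc (mu + 1) 0%N = besselc mu 0%N.
  have m0 : 0 < mu + 1 by lra.
  rewrite /besselc !expr0 !addr0 fact0 GammaS// mul1r.
  have := Gamma_gt0 m0; move: (Gamma _) => G G0.
  by field; rewrite !gt_eqF.
have fin := three_term_series base step.
have C m : -1 < m -> pseries (besselc m) z @ \oo --> besselE m z.
  by move=> m1; exact: is_cvg_besselE.
have L : (fun n => z * pseries (besselc (mu + 1 + 1)) z n
   - (mu + 1) * pseries (besselc (mu + 1)) z n.+1 + pseries (besselc mu) z n.+1) @ \oo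
   --> z * besselE (mu + 1 + 1) z - (mu + 1) * besselE (mu + 1) z + besselE mu z.
  apply: cvgD; last by rewrite (cvg_shiftS (pseries (besselc mu) z)); exact: C.
  apply: cvgB.
    by apply: cvgM; [exact: cvg_cst|exact: C].
  apply: cvgM; first exact: cvg_cst.
  by rewrite (cvg_shiftS (pseries (besselc (mu + 1)) z)); exact: C.
apply: (cvg_unique _ L) => //.
by rewrite /= (eq_cvg _ _ fin); exact: cvg_cst.
Qed.

Lemma besselJE mu x : besselJ mu x = (x / 2) `^ mu * besselE mu ((x / 2) ^+ 2).
Proof.
rewrite /besselJ /besselE /pseries; congr (_ * _).
by congr (limn (series _)); apply/funext => k; rewrite exprM.
Qed.

(** This is [2^mu sqrt y J_mu y]: a pure power times an entire function. The constant reappears as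
    [2^(- mu)] in the kernel and as [2^mu] in the value of the integral. *)
Definition besselW mu y : R := y `^ (mu + 1 / 2) * besselE mu (y ^+ 2 / 4).

Lemma sqrt_besselJ mu y : 0 < y ->
  Num.sqrt y * besselJ mu y = 2 `^ (- mu) * besselW mu y.
Proof.
move=> y0; rewrite besselJE /besselW -powR12_sqrt ?ltW// powRDpos//.
rewrite powRM ?invr_ge0 ?ltW// -(powR_inv1 (ler0n R 2)) -powRrM mulN1r.
rewrite (powR_inv1 (ler0n R 2)) expr_div_n (_ : (2 ^+ 2 : R) = 4); last by ring.
by rewrite div1r; ring.
Qed.

Lemma is_derive_besselE_sqr mu y : -1 < mu ->
  is_derive y 1 (fun y => besselE mu (y ^+ 2 / 4)) (- (y / 2) * besselE (mu + 1) (y ^+ 2 / 4)).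
Proof.
move=> mu1.
have d1 : is_derive y 1 (fun y : R => y ^+ 2 / 4) (y / 2).
  have d0 := is_deriveM_fun (is_derive_sqr y) (is_derive_cst (4^-1 : R) y 1).
  apply: (is_derive_eq d0).
  by rewrite /=; field.
apply: (is_derive_eq (@is_derive_comp_fun _ (besselE mu) _ y _ _ (is_derive_besselE _ mu1) d1)).
by ring.
Qed.

Definition besselW1 mu y : R := (mu + 1 / 2) * y `^ (mu - 1 / 2) * besselE mu (y ^+ 2 / 4)
  - y `^ (mu + 3 / 2) / 2 * besselE (mu + 1) (y ^+ 2 / 4).

Lemma is_derive_besselW mu y : -1 < mu -> 0 < y ->
  is_derive y 1 (besselW mu) (besselW1 mu y).
Proof.
move=> mu1 y0.
apply: (is_derive_eq (is_deriveM_fun (is_derive1_powR _ y0) (is_derive_besselE_sqr y mu1))).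
have e1 : y `^ (mu + 1 / 2) = y `^ (mu - 1 / 2) * y.
  by rewrite -{3}(powRr1 (ltW y0)) -powRDpos//; congr (_ `^ _); field.
have e3 : y `^ (mu + 3 / 2) = y `^ (mu - 1 / 2) * y ^+ 2.
  by rewrite -(powR_mulrn 2 (ltW y0)) -powRDpos//; congr (_ `^ _); field.
rewrite /besselW1 e1 e3 (_ : mu + 1 / 2 - 1 = mu - 1 / 2); last by field.
by move: (besselE mu _) (besselE (mu + 1) _) (y `^ _) => b0 b1 p; field.
Qed.

(** Multiplying [J_mu] by [sqrt y] removes the first-order term of Bessel's equation, which is the
    form needed for the energy estimate. *)
Lemma is_derive_besselW1 mu y : -1 < mu -> 0 < y ->
  is_derive y 1 (besselW1 mu) (((mu ^+ 2 - 4^-1) / y ^+ 2 - 1) * besselW mu y).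
Proof.
move=> mu1 y0; have mu2 : -1 < mu + 1 by lra.
have dA := is_deriveM_fun (is_deriveM_fun (is_derive_cst (mu + 1 / 2) y 1) (is_derive1_powR (mu - 1 / 2) y0))
  (is_derive_besselE_sqr y mu1).
have dB := is_deriveM_fun (is_deriveM_fun (is_derive1_powR (mu + 3 / 2) y0) (is_derive_cst (2^-1 : R) y 1))
  (is_derive_besselE_sqr y mu2).
apply: (is_derive_eq (is_deriveD_fun dA (is_deriveN dB))).
have ode := besselE_ode (y ^+ 2 / 4) mu1.
(* The equation eliminates the lowest order; once all powers of [y] are multiples of [p], what
   remains is a rational identity. *)
have e : besselE mu (y ^+ 2 / 4) = (mu + 1) * besselE (mu + 1) (y ^+ 2 / 4)
   - y ^+ 2 / 4 * besselE (mu + 1 + 1) (y ^+ 2 / 4).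
  move: ode; move: (besselE mu _) (besselE (mu + 1) _) (besselE _ _) => b0 b1 b2 ode.
  by apply/eqP; rewrite -subr_eq0 -ode; apply/eqP; ring.
rewrite /besselW e /=.
set p := y `^ (mu - 1 / 2 - 1).
have e0 : y `^ (mu - 1 / 2) = p * y.
  by rewrite -{2}(powRr1 (ltW y0)) -powRDpos//; congr (_ `^ _); field.
have e1 : y `^ (mu + 1 / 2) = p * y ^+ 2.
  by rewrite -(powR_mulrn 2 (ltW y0)) -powRDpos//; congr (_ `^ _); field.
have e2 : y `^ (mu + 3 / 2) = p * y ^+ 3.
  by rewrite -(powR_mulrn 3 (ltW y0)) -powRDpos//; congr (_ `^ _); field.
have e3 : y `^ (mu + 3 / 2 - 1) = p * y ^+ 2.
  by rewrite -(powR_mulrn 2 (ltW y0)) -powRDpos//; congr (_ `^ _); field.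
rewrite e0 e1 e2 e3.
move: (besselE (mu + 1) _) (besselE (mu + 1 + 1) _) p {e0 e1 e2 e3} => b1 b2 p.
by field; rewrite gt_eqF.
Qed.

Lemma continuous_besselW mu y : -1 < mu -> 0 < y -> {for y, continuous (besselW mu)}.
Proof. by move=> mu1 y0; apply: is_derive_continuous; exact: is_derive_besselW. Qed.

(* [W'' = (c / y^2 - 1) W], so [(W^2 + W'^2) exp (|c| / y)] does not increase. *)
Lemma besselW_bounded mu : -1 < mu -> exists M, forall y, 1 <= y -> `|besselW mu y| <= M.
Proof.
move=> mu1; pose c := mu ^+ 2 - 4^-1.
pose V y := besselW mu y * besselW mu y + besselW1 mu y * besselW1 mu y.
pose N y := V y * expR (`|c| * y^-1).
have dE y : 0 < y -> is_derive y 1 (fun y => expR (`|c| * y^-1)) (expR (`|c| * y^-1) * (`|c| * - y ^- 2)).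
  move=> y0; have yn : y != 0 by rewrite gt_eqF.
  have dV := @is_deriveV _ id y 1 1 yn (is_derive_id y 1).
  apply: (is_derive_eq (@is_derive_comp_fun _ expR _ y _ _ (is_derive_expR _)
     (is_deriveM_fun (is_derive_cst `|c| y 1) dV))).
  by rewrite /GRing.scale/= mul0r add0r mulr1.
have dN y : 0 < y -> is_derive y 1 N (expR (`|c| * y^-1) / y ^+ 2 *
   (2 * c * (besselW mu y * besselW1 mu y) - `|c| * V y)).
  move=> y0; have dW := is_derive_besselW mu1 y0; have dW1 := is_derive_besselW1 mu1 y0.
  apply: (is_derive_eq (is_deriveM_fun (is_deriveD_fun (is_deriveM_fun dW dW) (is_deriveM_fun dW1 dW1)) (dE y y0))).
  rewrite -/c /V; move: (besselW mu y) (besselW1 mu y) (expR _) => u v p.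
  by field; rewrite gt_eqF.
have V0 y : 0 <= V y by rewrite addr_ge0// -expr2 sqr_ge0.
have Ny y : 1 <= y -> N y <= N 1.
  move=> y1; apply: (@ler0_derive1_nincry _ N 1) => //.
  - move=> x; rewrite in_itv/= andbT => x1.
    by have [] := dN x (lt_trans ltr01 x1).
  - move=> x; rewrite in_itv/= andbT => x1; have x0 := lt_trans ltr01 x1.
    rewrite derive1E; have [_ ->] := dN x x0.
    apply: mulr_ge0_le0; first by rewrite divr_ge0 ?expR_ge0 ?sqr_ge0.
    (* The perturbation [2 c W W'] is absorbed by [|c| V], the term produced by differentiating
       [exp (|c| / y)]. *)
    have h : `|2 * (besselW mu x * besselW1 mu x)| <= V x.
      rewrite /V; move: (besselW mu x) (besselW1 mu x) => u v.
      have h1 := sqr_ge0 (u + v); have h2 := sqr_ge0 (u - v).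
      by rewrite ler_norml; apply/andP; split; lra.
    rewrite subr_le0 (_ : 2 * c * _ = c * (2 * (besselW mu x * besselW1 mu x))); last first.
      by rewrite -mulrA mulrCA.
    by rewrite (le_trans (ler_norm _))// normrM ler_wpM2l.
  - apply: continuous_in_subspaceT => x; rewrite inE/= in_itv/= andbT => x1.
    by apply: is_derive_continuous; apply: dN; exact: lt_le_trans x1.
(* From [W^2 <= N 1] one gets [|W| <= 1 + N 1] without taking a square root. *)
exists (1 + N 1) => y y1.
have y0 : 0 < y by exact: lt_le_trans y1.
have h : besselW mu y ^+ 2 <= N 1.
  apply: le_trans (Ny y y1); apply: (@le_trans _ _ (V y)).
    by rewrite expr2 lerDl -expr2 sqr_ge0.
  rewrite ler_peMr// -expR0 ler_expR mulr_ge0// invr_ge0 ltW//.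
have N0 : 0 <= N 1 by apply: le_trans h; exact: sqr_ge0.
have : `|besselW mu y| ^+ 2 <= N 1 by rewrite real_normK// num_real.
by move: N0; move: (`|besselW mu y|) (N 1) => u v ? ?; nra.
Qed.

(** As [mu + 1/2 >= 0], the factor [y^(mu + 1/2)] is at most 1 before [y = 1] and at least 1 after
    it, so the bound natural on each side implies the other one there. *)
Lemma besselW_bound mu : -(1/2) <= mu -> exists2 M, 0 < M &
  forall y, 0 < y -> `|besselW mu y| <= M /\ `|besselW mu y| <= M * y `^ (mu + 1 / 2).
Proof.
move=> mu2; have mu1 : -1 < mu by lra.
have a0 : 0 <= mu + 1 / 2 by lra.
have [M1 HM1] := besselW_bounded mu1.
(* For [y <= 1] the argument [y^2 / 4] of [besselE] is at most [1/4]. *)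
pose M2 := gamma_lb^-1 * expR (4^-1).
have M20 : 0 < M2 by rewrite mulr_gt0 ?invr_gt0 ?expR_gt0.
exists (`|M1| + M2); first by rewrite ltr_wpDl.
move=> y y0; have [y1|y1] := leP y 1.
- have hE : `|besselE mu (y ^+ 2 / 4)| <= M2.
    apply: (le_trans (besselE_bound _ mu1)).
    rewrite ler_wpM2l ?invr_ge0 ?(ltW gamma_lb_gt0)// ler_expR.
    rewrite ger0_norm ?divr_ge0 ?sqr_ge0// ler_pdivrMr// mulVf//.
    by rewrite expr_le1// ltW.
  have h : `|besselW mu y| <= M2 * y `^ (mu + 1 / 2).
    by rewrite normrM (ger0_norm (powR_ge0 _ _)) mulrC ler_wpM2r ?powR_ge0.
  have p1 : y `^ (mu + 1 / 2) <= 1.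
    have y01 : 0 < y <= 1 by rewrite y0 y1.
    by rewrite -[leRHS](powRr0 y); exact: (ger_powR y01 a0).
  have p0 : 0 <= y `^ (mu + 1 / 2) by exact: powR_ge0.
  have n0 : 0 <= `|M1| by [].
  clear hE; clearbody M2; move: h p1 p0 n0 M20; move: (`|besselW mu y|) (y `^ _) (`|M1|) M2 => u v m1 m2 ? ? ? ? ?.
  by split; nra.
- have h := HM1 y (ltW y1).
  have p1 : 1 <= y `^ (mu + 1 / 2).
    by rewrite -[leLHS](powRr0 y) ler_powR// ltW.
  have n0 : M1 <= `|M1| by exact: ler_norm.
  have m0 : 0 <= `|M1| by [].
  clearbody M2; move: h p1 n0 m0 M20; move: (`|besselW mu y|) (y `^ _) (`|M1|) M2 => u v m1 m2 ? ? ? ? ?.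
  by split; nra.
Qed.

End BesselEntire.

(** * Integrals with indicator factors and termwise integration of series *)

Section TermwiseIntegration.
Context d (T : measurableType d) (R : realType) (mu : {measure set T -> \bar R}).
Variables (D : set T) (mD : measurable D).

Lemma integral_indicM (k : T -> R) :
  (\int[mu]_x (\1_D x * k x)%:E = \int[mu]_(x in D) (k x)%:E)%E.
Proof.
rewrite [RHS]integral_mkcond; apply: eq_integral => x _.
rewrite patchE indicE; case: (x \in D); first by rewrite mul1r.
by rewrite mul0r.
Qed.

(** The inner integral has to be known only for parameters in [A], which lets Fubini run over the
    whole plane with indicator factors in the integrand. *)
Lemma integral_indic_outer T' (A : set T') (y : T') (k : T -> R) (r : R) :
  (A y -> (\int[mu]_x (k x)%:E = r%:E)%E) ->
  (\int[mu]_x (\1_A y * k x)%:E = (\1_A y * r)%:E)%E.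
Proof.
rewrite indicE; case: (boolP (y \in A)) => [/set_mem Ay /(_ Ay)|_ _].
  by rewrite mul1r => <-; apply: eq_integral => x _; rewrite mul1r.
by rewrite mul0r; apply: integral0_eq => x _; rewrite mul0r.
Qed.

(** Dominated convergence for the partial sums: the dominating function is the sum of the [|f k|],
    whose integral is the sum of the [J k]. *)
Lemma integral_series_termwise (f : nat -> T -> R) (F : T -> R) (I J : nat -> R) (L : R) :
  (forall k, measurable_fun D (f k)) ->
  (forall k, (\int[mu]_(x in D) `|f k x|%:E = (J k)%:E)%E) ->
  (forall k, (\int[mu]_(x in D) (f k x)%:E = (I k)%:E)%E) ->
  cvgn (series J) -> series I @ \oo --> L ->
  (forall x, D x -> series (f ^~ x) @ \oo --> F x) ->
  mu.-integrable D (EFin \o F) /\ (\int[mu]_(x in D) (F x)%:E = L%:E)%E.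
Proof.
move=> mf HJ HI cJ cI cF.
pose g x := (\sum_(0 <= k <oo) `|f k x|%:E)%E.
have g0 k x : (0 <= `|f k x|%:E)%E by rewrite lee_fin.
have mfa k : measurable_fun D (fun x => `|f k x|%:E).
  by apply/measurable_EFinP; exact: measurableT_comp.
have intf k : mu.-integrable D (EFin \o f k).
  apply/integrableP; split; first exact/measurable_EFinP.
  by under eq_integral do rewrite /=; rewrite HJ ltry.
have intg : mu.-integrable D g.
  apply/integrableP; split.
    have := @ge0_emeasurable_sum _ _ _ D (fun k x => `|f k x|%:E) xpredT (fun k x _ _ => g0 k x) (fun k _ => mfa k).
    by apply: eq_measurable_fun.
  under eq_integral.
    move=> x _; rewrite gee0_abs; last by apply: nneseries_ge0 => n _ _; exact: g0.
    over.
  rewrite /g integral_nneseries//.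
  under eq_eseriesr do rewrite HJ.
  rewrite (_ : limn _ = (limn (series J))%:E) ?ltry//.
  rewrite -EFin_lim//; congr (limn _); apply/funext => n.
  by rewrite /series/= sumEFin.
have mF : measurable_fun D F.
  apply/measurable_EFinP; apply: (emeasurable_fun_cvg (fun n x => (series (f ^~ x) n)%:E)).
    move=> n; under eq_fun do rewrite /series/= -sumEFin.
    by apply: emeasurable_sum => k; exact/measurable_EFinP.
  by move=> x Dx; apply: cvg_EFin; [exact: nearW|exact: cF].
have [] := @dominated_convergence _ _ _ mu D mD (fun n x => (series (f ^~ x) n)%:E) (EFin \o F) g.
- move=> n; under eq_fun do rewrite /series/= -sumEFin.
  by apply: emeasurable_sum => k; exact/measurable_EFinP.
- exact/measurable_EFinP.
- by apply: aeW => x Dx; apply: cvg_EFin; [exact: nearW|exact: cF].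
- exact: intg.
- apply: aeW => x n Dx; rewrite /=.
  apply: (@le_trans _ _ (\sum_(0 <= k < n) `|f k x|%:E)%E).
    by rewrite sumEFin lee_fin /series/=; exact: ler_norm_sum.
  by apply: nneseries_lim_ge => k _ _; exact: g0.
move=> intF _ /= A; split=> //.
apply: (cvg_unique (@ereal_hausdorff R) A) => /=.
rewrite (eq_cvg _ _ (_ : _ =1 fun n => (series I n)%:E)).
  by apply: cvg_EFin; [exact: nearW|exact: cI].
move=> n; under eq_integral do rewrite /series/= -sumEFin.
rewrite integral_sum//; under eq_bigr do rewrite HI.
by rewrite sumEFin.
Qed.

End TermwiseIntegration.

(** * Weber's Gaussian integral and the value of the limiting integral *)

Section WeberIntegral.
Context {R : realType}.
Implicit Types (mu eta s t x y : R) (k n : nat).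
Local Notation Rpos := (`]0, +oo[%classic : set R).
Local Notation lmu := (@lebesgue_measure R).

(** The exponent is left in the form [2 s - 1] with [s = mu + k + 1], so that the Gaussian moment
    produces the very Gamma value in the denominator of [besselc]. *)
Definition weber_term mu t k y : R :=
  besselc mu k * 4^-1 ^+ k * (y `^ (2 * (mu + k%:R + 1) - 1) * expR (- (t * y ^+ 2))).

Lemma measurable_powR_gauss p t :
  measurable_fun (setT : set R) (fun y => y `^ p * expR (- (t * y ^+ 2))).
Proof.
apply: measurable_funM; first exact: measurable_powR.
apply: measurableT_comp => //; apply: measurableT_comp => //.
by apply: measurable_funM => //; exact: measurable_funX.
Qed.

Lemma powR_gauss_ge0 p t y : 0 <= y `^ p * expR (- (t * y ^+ 2)).
Proof. by rewrite mulr_ge0 ?powR_ge0 ?expR_ge0. Qed.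

(** After cancellation of the Gamma values, absolute values merely drop the alternating sign: the
    norms sum to an exponential at [1/(4 t)], the terms themselves to one at [- 1/(4 t)]. *)
Lemma integral_weber_term_norm mu t k : -1 < mu -> 0 < t ->
  (\int[lmu]_(y in Rpos) `|weber_term mu t k y|%:E =
   (t `^ (- mu - 1) / 2 * exp_coeff (4 * t)^-1 k)%:E)%E.
Proof.
move=> mu1 t0; have s0 := besselc_arg_gt0 k mu1.
under eq_integral do rewrite /weber_term normrM (ger0_norm (powR_gauss_ge0 _ _ _)) EFinM.
rewrite ge0_integralZl//; last 2 first.
- by apply/measurable_EFinP/measurable_funTS; exact: measurable_powR_gauss.
- by move=> y _; rewrite lee_fin powR_gauss_ge0.
rewrite Gamma_sqr// -EFinM; congr EFin.
have G0 := Gamma_gt0 s0.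
rewrite /besselc /exp_coeff/= !normrM normrX normrN1 expr1n mul1r normfV normrM.
rewrite !ger0_norm ?ler0n ?exprn_ge0 ?invr_ge0 ?(ltW G0)//.
have -> : t `^ (- (mu + k%:R + 1)) = t `^ (- mu - 1) * t^-1 ^+ k.
  rewrite exprVn -powR_invn ?(ltW t0)// -powRDpos//; congr (_ `^ _); ring.
rewrite [(4 * t)^-1]invfM exprMn.
have f0 : k`!%:R != 0 :> R by rewrite pnatr_eq0 -lt0n fact_gt0.
move: (Gamma _) G0 (t `^ _) (t^-1 ^+ k) (4^-1 ^+ k) => G G0 a b c.
by field; rewrite f0 gt_eqF.
Qed.

Lemma integral_weber_term mu t k : -1 < mu -> 0 < t ->
  (\int[lmu]_(y in Rpos) (weber_term mu t k y)%:E =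
   (t `^ (- mu - 1) / 2 * exp_coeff (- (4 * t)^-1) k)%:E)%E.
Proof.
move=> mu1 t0; have s0 := besselc_arg_gt0 k mu1.
under eq_integral do rewrite /weber_term EFinM.
rewrite integralZl//; last first.
  apply/integrableP; split.
    by apply/measurable_EFinP/measurable_funTS; exact: measurable_powR_gauss.
  under eq_integral do rewrite /= (ger0_norm (powR_gauss_ge0 _ _ _)).
  by rewrite Gamma_sqr// ltry.
rewrite Gamma_sqr// -EFinM; congr EFin.
have G0 := Gamma_gt0 s0.
rewrite /besselc /exp_coeff/=.
have -> : t `^ (- (mu + k%:R + 1)) = t `^ (- mu - 1) * t^-1 ^+ k.
  rewrite exprVn -powR_invn ?(ltW t0)// -powRDpos//; congr (_ `^ _); ring.
rewrite -[- (4 * t)^-1]mulN1r [(4 * t)^-1]invfM !exprMn.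
have f0 : k`!%:R != 0 :> R by rewrite pnatr_eq0 -lt0n fact_gt0.
move: (Gamma _) G0 (t `^ _) (t^-1 ^+ k) (4^-1 ^+ k) ((-1) ^+ k) => G G0 a b c d.
by field; rewrite f0 gt_eqF.
Qed.

Lemma integrable_gamma_scale s t : 0 < s -> 0 < t ->
  lmu.-integrable Rpos (EFin \o (fun u => u `^ (s - 1) * expR (- (t * u)))).
Proof.
move=> s0 t0; apply/integrableP; split.
  apply/measurable_EFinP/measurable_funTS; apply: measurable_funM; first exact: measurable_powR.
  by apply: measurableT_comp => //; apply: measurableT_comp => //; exact: measurable_funM.
under eq_integral do rewrite /= (ger0_norm (mulr_ge0 (powR_ge0 _ _) (expR_ge0 _))).
by rewrite Gamma_scale// ltry.
Qed.

Lemma weber_integral mu t : -1 < mu -> 0 < t ->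
  lmu.-integrable Rpos (EFin \o
    (fun y => y `^ (2 * mu + 1) * besselE mu (y ^+ 2 / 4) * expR (- (t * y ^+ 2)))) /\
  (\int[lmu]_(y in Rpos) (y `^ (2 * mu + 1) * besselE mu (y ^+ 2 / 4) * expR (- (t * y ^+ 2)))%:E =
   (t `^ (- mu - 1) / 2 * expR (- (4 * t)^-1))%:E)%E.
Proof.
move=> mu1 t0; pose c := t `^ (- mu - 1) / 2.
apply: (@integral_series_termwise _ _ _ lmu Rpos _ (weber_term mu t) _
  (fun k => c * exp_coeff (- (4 * t)^-1) k) (fun k => c * exp_coeff (4 * t)^-1 k)) => //.
- move=> k; apply: measurable_funM => //.
  by apply: measurable_funTS; exact: measurable_powR_gauss.
- by move=> k; exact: integral_weber_term_norm.
- by move=> k; exact: integral_weber_term.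
- rewrite (_ : (fun k => _) = c *: exp_coeff (4 * t)^-1)//.
  by apply: is_cvg_seriesZ; exact: is_cvg_series_exp_coeff.
- rewrite (_ : (fun k => _) = c *: exp_coeff (- (4 * t)^-1))//.
  have H : series (exp_coeff (- (4 * t)^-1)) @ \oo --> expR (- (4 * t)^-1).
    exact: is_cvg_series_exp_coeff.
  rewrite (_ : series _ = (fun n => c * series (exp_coeff (- (4 * t)^-1)) n)).
    by apply: cvgM; [exact: cvg_cst|exact: H].
  by apply/funext => n; rewrite /series/= mulr_sumr.
- move=> y /=; rewrite in_itv/= andbT => y0.
  pose q := y `^ (2 * mu + 1) * expR (- (t * y ^+ 2)).
  rewrite (_ : _ * _ * _ = q * besselE mu (y ^+ 2 / 4)); last by rewrite /q mulrAC.
  rewrite (_ : series _ = (fun n => q * pseries (besselc mu) (y ^+ 2 / 4) n)).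
    by apply: cvgM; [exact: cvg_cst|exact: is_cvg_besselE].
  apply/funext => n; rewrite /pseries /series/= mulr_sumr; apply: eq_bigr => k _.
  rewrite /weber_term /q.
  have -> : y `^ (2 * (mu + k%:R + 1) - 1) = y `^ (2 * mu + 1) * (y ^+ 2) ^+ k.
    rewrite -exprM -(powR_mulrn (2 * k) (ltW y0)) -powRDpos// natrM; congr (_ `^ _); ring.
  rewrite [(_ / 4) ^+ k]exprMn; move: (besselc mu k) (y `^ _) ((y ^+ 2) ^+ k) (4^-1 ^+ k) (expR _) => *; ring.
Qed.

Lemma measurable_besselE mu : -1 < mu ->
  measurable_fun (setT : set R) (fun y => besselE mu (y ^+ 2 / 4)).
Proof.
move=> mu1; apply: continuous_measurable_fun => y.
by apply: is_derive_continuous; exact: is_derive_besselE_sqr.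
Qed.

Lemma measurable_besselW mu : -1 < mu -> measurable_fun (setT : set R) (besselW mu).
Proof.
by move=> mu1; apply: measurable_funM; [exact: measurable_powR|exact: measurable_besselE].
Qed.

(** Near 0 the exponent [mu + 1 - eta] exceeds [-1] because [eta < mu + 2]; near infinity
    [1/2 - eta] is below [-1] because [eta > 3/2]. *)
Lemma integrable_besselW mu eta : -(1/2) <= mu -> 3 / 2 < eta < mu + 2 ->
  lmu.-integrable Rpos (EFin \o (fun y => y `^ (1 / 2 - eta) * besselW mu y)).
Proof.
move=> mu1 /andP[e1 e2]; have mu2 : -1 < mu by lra.
have [M M0 HM] := besselW_bound mu1.
apply: (@halfline_integrable_dom _ _ (mu + 1 - eta) (eta - 1 / 2) M); [lra|lra|..].
- apply: measurable_funTS; apply: measurable_funM; first exact: measurable_powR.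
  exact: measurable_besselW.
- move=> y y0 _; rewrite normrM ger0_norm ?powR_ge0//.
  rewrite (_ : mu + 1 - eta = (1 / 2 - eta) + (mu + 1 / 2)); last by field.
  rewrite [X in M * X]powRDpos// mulrCA ler_wpM2l ?powR_ge0//.
  by have [] := HM y y0.
- move=> y y1; have y0 : 0 < y by exact: lt_le_trans y1.
  rewrite normrM ger0_norm ?powR_ge0// opprB mulrC ler_wpM2r ?powR_ge0//.
  by have [] := HM y y0.
Qed.

Lemma powR_quarter x : 4^-1 `^ (- x) = 2 `^ (2 * x) :> R.
Proof.
have e : 4^-1 = 2 `^ (- 2%:R) :> R.
  by rewrite powR_invn// expr2 -natrM.
by rewrite e -powRrM; congr (_ `^ _); rewrite mulrNN.
Qed.

(** The power of [1/4] equals [2^(2 + mu - eta)]; with the factor [1/2] it becomes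
    [2^mu / 2^(eta - 1)]. *)
Lemma Hconst_solve mu eta (G1 G2 I : R) : 0 < G1 ->
  G1 * I = 2^-1 * (G2 * 4^-1 `^ (- (1 + mu / 2 - eta / 2))) ->
  I = 2 `^ mu * (G2 / (2 `^ (eta - 1) * G1)).
Proof.
move=> G10; rewrite powR_quarter.
have -> : 2 `^ (2 * (1 + mu / 2 - eta / 2)) = 2 `^ mu / 2 `^ (eta - 1) * 2 :> R.
  rewrite -powRN -powRDpos// -[X in _ = _ * X]powRr1// -powRDpos//.
  by congr (_ `^ _); field.
have q0 : 0 < 2 `^ (eta - 1) :> R by apply: powR_gt0.
move: (2 `^ mu) (2 `^ (eta - 1)) q0 => a b q0 E.
have G1n : G1 != 0 by rewrite gt_eqF.
by rewrite -[I](mulKf G1n) E; field; rewrite !gt_eqF.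
Qed.

(* [y^(-2 s)] is written as the Gaussian mixture
   [1/Gamma s * int_0^oo t^(s-1) exp (- t y^2) dt], with [2 s = mu + eta], and
   the order of integration is exchanged. *)
Lemma integral_besselW mu eta : -(1/2) <= mu -> 3 / 2 < eta < mu + 2 ->
  \int[lmu]_(y in Rpos) (y `^ (1 / 2 - eta) * besselW mu y) = 2 `^ mu * Hconst mu eta.
Proof.
move=> mu1 heta; have mu2 : -1 < mu by lra.
have /andP[e1 e2] := heta.
(* Integrating over [y] first leaves [t^(s - 1) t^(- mu - 1) = t^(- p - 1)], which determines [p];
   it is positive exactly when [eta < mu + 2]. *)
pose s := (mu + eta) / 2; pose p := 1 + mu / 2 - eta / 2.
have s0 : 0 < s by rewrite /s; lra.
have p0 : 0 < p by rewrite /p; lra.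
have Iw := integrable_besselW mu1 heta.
pose B y := y `^ (2 * mu + 1) * besselE mu (y ^+ 2 / 4).
pose h y t := B y * (t `^ (s - 1) * expR (- (y ^+ 2 * t))).
pose f (z : R * R) := (\1_Rpos z.1 * (\1_Rpos z.2 * h z.1 z.2))%:E.
have mB : measurable_fun (setT : set R) B.
  by apply: measurable_funM; [exact: measurable_powR|exact: measurable_besselE].
have mf : measurable_fun (setT : set (R * R)) f.
  apply/measurable_EFinP; apply: measurable_funM.
    by apply: measurableT_comp; [exact: measurable_indic|exact: measurable_fst].
  apply: measurable_funM.
    by apply: measurableT_comp; [exact: measurable_indic|exact: measurable_snd].
  apply: measurable_funM.
    by apply: measurableT_comp; [exact: mB|exact: measurable_fst].
  apply: measurable_funM.
    by apply: (measurableT_comp (measurable_powR _)); exact: measurable_snd.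
  apply: measurableT_comp => //; apply: measurableT_comp => //.
  apply: measurable_funM; last exact: measurable_snd.
  by apply: measurable_funX; exact: measurable_fst.
have inner y : 0 < y -> B y * (Gamma s * (y ^+ 2) `^ (- s)) =
    Gamma s * (y `^ (1 / 2 - eta) * besselW mu y).
  move=> y0; rewrite /B /besselW.
  have -> : (y ^+ 2) `^ (- s) = y `^ (- mu - eta).
    by rewrite -(powR_mulrn 2 (ltW y0)) -powRrM; congr (_ `^ _); rewrite /s; field.
  have P : y `^ (2 * mu + 1) * y `^ (- mu - eta) = y `^ (1 / 2 - eta) * y `^ (mu + 1 / 2).
    by rewrite -!powRDpos//; congr (_ `^ _); field.
  move: P; move: (Gamma s) (besselE mu _) => G E.
  move: (y `^ (2 * mu + 1)) (y `^ (- mu - eta)) (y `^ (1 / 2 - eta)) (y `^ (mu + 1 / 2)) => a b c d P.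
  rewrite (_ : a * E * (G * b) = G * E * (a * b)); last by ring.
  by rewrite P; ring.
have fin_y y : (\int[lmu]_t f (y, t) =
    (\1_Rpos y * (Gamma s * (y `^ (1 / 2 - eta) * besselW mu y)))%:E)%E.
  apply: integral_indic_outer; rewrite /= in_itv/= andbT => y0.
  rewrite integral_indicM; under eq_integral do rewrite EFinM.
  have y2 : 0 < y ^+ 2 by rewrite exprn_gt0.
  by rewrite integralZl//; [rewrite Gamma_scale// -EFinM inner|exact: integrable_gamma_scale].
have nI (A : set R) (x : R) : `|\1_A x| = \1_A x :> R by rewrite indicE normr_nat.
(* Since the mixture is positive, integrating [|f|] over [t] gives back [Gamma s] times the absolute
   value of the original integrand. Absolute convergence of the double integral thus reduces to
   [integrable_besselW]. *)
have fin_ya y : (\int[lmu]_t `|f (y, t)| =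
    (\1_Rpos y * (Gamma s * `|y `^ (1 / 2 - eta) * besselW mu y|))%:E)%E.
  under eq_integral do rewrite /f/= normrM (normrM (\1_Rpos _)) !nI.
  apply: integral_indic_outer; rewrite /= in_itv/= andbT => y0.
  rewrite integral_indicM.
  have hn t : `|h y t| = `|B y| * (t `^ (s - 1) * expR (- (y ^+ 2 * t))).
    by rewrite /h normrM; congr (_ * _); rewrite ger0_norm// mulr_ge0 ?powR_ge0 ?expR_ge0.
  under eq_integral do rewrite hn EFinM.
  have y2 : 0 < y ^+ 2 by rewrite exprn_gt0.
  rewrite integralZl//; last exact: integrable_gamma_scale.
  rewrite Gamma_scale// -EFinM; congr EFin.
  have Gs0 := Gamma_gt0 s0.
  have -> x : Gamma s * `|x| = `|Gamma s * x| by rewrite normrM (gtr0_norm Gs0).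
  by rewrite -inner// (normrM (B y)) [X in _ = _ * X]ger0_norm// mulr_ge0 ?powR_ge0// ltW.
have fin_t t : (\int[lmu]_y f (y, t) =
    (\1_Rpos t * (2^-1 * (t `^ (- p - 1) * expR (- (4^-1 / t)))))%:E)%E.
  under eq_integral do rewrite /f/= mulrCA.
  apply: integral_indic_outer; rewrite /= in_itv/= andbT => t0.
  rewrite integral_indicM.
  have [Ih Eh] := weber_integral mu2 t0.
  under eq_integral => y _.
    rewrite /h mulrCA EFinM (mulrC (y ^+ 2) t); over.
  rewrite integralZl// Eh -EFinM; congr EFin.
  have -> : t `^ (- p - 1) = t `^ (s - 1) * t `^ (- mu - 1).
    by rewrite -powRDpos//; congr (_ `^ _); rewrite /s /p; field.
  rewrite [(4 * t)^-1]invfM; move: (t `^ (s - 1)) (t `^ (- mu - 1)) (expR _) => a b c; ring.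
have intf : (lmu \x lmu)%E.-integrable setT f.
  apply/integrable12ltyP => //.
  under eq_integral do rewrite fin_ya.
  rewrite integral_indicM//.
  under eq_integral do rewrite EFinM.
  rewrite ge0_integralZl//; last 2 first.
  - have mw := measurable_integrableR Iw.
    by apply/measurable_EFinP; exact: measurableT_comp.
  - by rewrite lee_fin ltW// Gamma_gt0.
  have /integrableP[_ fI] := Iw.
  by rewrite lte_mul_pinfty// lee_fin ltW// Gamma_gt0.
have F := Fubini intf.
have L : (\int[lmu]_y \int[lmu]_t f (y, t) =
    (Gamma s * \int[lmu]_(y in Rpos) (y `^ (1 / 2 - eta) * besselW mu y))%:E)%E.
  under eq_integral do rewrite fin_y.
  rewrite [LHS]integral_indicM.
  under eq_integral do rewrite EFinM.
  rewrite [LHS]integralZl; [|exact: measurable_itv|exact: Iw].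
  rewrite EFinM; congr (_ * _)%E.
  by rewrite /Rintegral fineK; [|exact: integrable_fin_num Iw].
have Rr : (\int[lmu]_t \int[lmu]_y f (y, t) = (2^-1 * (Gamma p * 4^-1 `^ (- p)))%:E)%E.
  under eq_integral do rewrite fin_t.
  rewrite [LHS]integral_indicM.
  under eq_integral do rewrite EFinM.
  rewrite [LHS]ge0_integralZl; last 4 first.
  - exact: measurable_itv.
  - apply/measurable_EFinP; apply: halfline_continuous_measurable => x x0.
    apply: cvgM; first exact: continuous_powR.
    apply: (@cvg_comp _ _ _ (fun y => - (4^-1 / y)) expR _ (nbhs (- (4^-1 / x)))); last exact: continuous_expR.
    have xn : x != 0 by rewrite gt_eqF.
    have d1 := is_deriveM_fun (is_derive_cst (4^-1 : R) x 1) (@is_deriveV _ id x 1 1 xn (is_derive_id x 1)).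
    by have /is_derive_continuous := is_deriveN d1.
  - by move=> t _; rewrite lee_fin mulr_ge0 ?powR_ge0 ?expR_ge0.
  - by rewrite lee_fin invr_ge0.
  by rewrite Gamma_inv; [rewrite EFinM|exact: p0|rewrite invr_gt0].
have Gs := Gamma_gt0 s0.
have E := EFin_inj (etrans (esym L) (etrans F Rr)); move: E.
rewrite /Hconst (_ : mu / 2 + eta / 2 = s); last by rewrite /s mulrDl.
exact: Hconst_solve.
Qed.

End WeberIntegral.

(** * Transfer from Lebesgue measure on Borel sets to its completion *)

Section CompletedLebesgue.
Context {R : realType}.
Local Notation lmu := (@lebesgue_measure R).
Local Notation cmu := (@completed_lebesgue_measure R).
Local Notation cR := (caratheodory_type (wlength (@idfun R))^*%mu).
Implicit Types (D : set R) (f : R -> R).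

Lemma measurable_completed D : (measurable : set (set R)) D -> (measurable : set (set cR)) D.
Proof. exact: sub_caratheodory. Qed.

Lemma measurable_fun_completed d (T : measurableType d) D (f : R -> T) :
  measurable D -> measurable_fun D f -> measurable_fun (D : set cR) (f : cR -> T).
Proof. by move=> mD mf _ Y mY; apply: sub_caratheodory; exact: mf. Qed.

(** The identity map is measurable from the completed to the Borel sigma-algebra and pushes the
    completed measure to Lebesgue measure. *)
Lemma ge0_integral_completed D (f : R -> \bar R) :
  measurable D -> measurable_fun D f -> {in D, forall y, 0 <= f y}%E ->
  (\int[cmu]_(x in D) f x = \int[lmu]_(x in D) f x)%E.
Proof.
move=> mD mf f0.
have mid : measurable_fun (setT : set cR) (idfun : cR -> measurableTypeR R).
  by move=> _ Y mY; rewrite setTI; exact: sub_caratheodory.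
by rewrite -(@ge0_integral_pushforward _ _ _ _ _ _ mid cmu D f).
Qed.

Lemma integrable_completed D f : measurable D -> lmu.-integrable D (EFin \o f) ->
  cmu.-integrable D (EFin \o f).
Proof.
move=> mD /integrableP[mf fI]; apply/integrableP; split.
  exact: measurable_fun_completed.
by rewrite ge0_integral_completed//; exact: measurableT_comp.
Qed.

Lemma Rintegral_completed D f : measurable D -> lmu.-integrable D (EFin \o f) ->
  \int[cmu]_(x in D) f x = \int[lmu]_(x in D) f x.
Proof.
move=> mD /measurable_int mf; rewrite /Rintegral; congr fine.
rewrite integralE [in RHS]integralE; congr (_ - _)%E; apply: ge0_integral_completed => //.
- exact: measurable_funepos.
- exact: measurable_funeneg.
Qed.

End CompletedLebesgue.

(** * Scaling of the Bessel integral and a bound for slowly growing functions *)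

Section RealLimit.
Context {R : realType}.
Variables (mu eta : R) (hmu : - (1 / 2) <= mu) (heta : 3 / 2 < eta < mu + 2).
Implicit Types (u r : R -> R) (k x X l : R).
Local Notation Rpos := (`]0, +oo[%classic : set R).
Local Notation lmu := (@lebesgue_measure R).
Local Notation cmu := (@completed_lebesgue_measure R).
Local Notation cR := (caratheodory_type (wlength (@idfun R))^*%mu).
Local Notation W := (besselW mu).
Local Notation w := (fun y => y `^ (1 / 2 - eta) * W y).

Let mu1 : -1 < mu. Proof. by move: hmu; lra. Qed.

Lemma measurable_Rpos_completed : measurable (Rpos : set cR).
Proof. by apply: measurable_completed; exact: measurable_itv. Qed.

Lemma measurable_itv_completed (i : interval R) : measurable ([set` i] : set cR).
Proof. by apply: measurable_completed; exact: measurable_itv. Qed.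

(** The rule for nonnegative integrands is applied to [|G|] and to [|G| + G]; subtracting gives the
    signed case. *)
Lemma halfline_scaleR (G : R -> R) k : 0 < k ->
  (forall x, 0 < x -> {for x, continuous G}) -> lmu.-integrable Rpos (EFin \o G) ->
  lmu.-integrable Rpos (EFin \o (fun x => k * G (k * x))) /\
  \int[lmu]_(x in Rpos) (k * G (k * x)) = \int[lmu]_(x in Rpos) G x.
Proof.
move=> k0 cG IG.
have cGk x : 0 < x -> {for x, continuous (fun x => k * G (k * x))}.
  move=> x0; apply: cvgM; first exact: cvg_cst.
  apply: (@cvg_comp _ _ _ (fun y => k * y) G _ (nbhs (k * x))); last by apply: cG; rewrite mulr_gt0.
  by apply: cvgM; [exact: cvg_cst|exact: cvg_id].
have IGk : lmu.-integrable Rpos (EFin \o (fun x => k * G (k * x))).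
  apply/integrableP; split.
    by apply/measurable_EFinP; exact: halfline_continuous_measurable.
  have /integrableP[_] := IG; under eq_integral do rewrite /=.
  rewrite (@halfline_scale _ (fun x => `|G x|) k)//; last first.
    by move=> x x0; apply: cvg_norm; exact: cG.
  by under [X in _ -> (X < _)%E]eq_integral do rewrite /= normrM (gtr0_norm k0).
split=> //.
have E : \int[lmu]_(x in Rpos) (k * (`|G (k * x)| + G (k * x))) =
         \int[lmu]_(x in Rpos) (`|G x| + G x).
  rewrite /Rintegral (@halfline_scale _ (fun x => `|G x| + G x) k)//.
  - by move=> x x0; apply: cvgD; [apply: cvg_norm; exact: cG|exact: cG].
  - by move=> x _; rewrite -lerBlDr sub0r -normrN ler_norm.
have E1 : \int[lmu]_(x in Rpos) (k * `|G (k * x)|) = \int[lmu]_(x in Rpos) `|G x|.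
  rewrite /Rintegral (@halfline_scale _ (fun x => `|G x|) k)//.
  by move=> x x0; apply: cvg_norm; exact: cG.
have IGa := integrable_norm IG.
have IGka : lmu.-integrable Rpos (EFin \o (fun x => k * `|G (k * x)|)).
  have := integrable_norm IGk; apply: eq_integrable => // x _ /=.
  by rewrite normrM (gtr0_norm k0).
move: E; rewrite [in RHS]RintegralD// -E1.
under eq_Rintegral do rewrite mulrDr.
by rewrite RintegralD// => /addrI.
Qed.

Lemma continuous_w x : 0 < x -> {for x, continuous w}.
Proof.
move=> x0; apply: cvgM; first exact: continuous_powR.
exact: continuous_besselW.
Qed.

Let wscale k x : 0 < k -> 0 < x ->
  x `^ (1 / 2 - eta) * W (k * x) = k `^ (eta - 3 / 2) * (k * w (k * x)).
Proof.
move=> k0 x0; rewrite /= powRM ?ltW//; move: (W _) => v.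
have P : k `^ (eta - 3 / 2) * k * k `^ (1 / 2 - eta) = 1.
  rewrite -{2}(powRr1 (ltW k0)) -!powRDpos//.
  by rewrite (_ : _ + _ = 0) ?powRr0//; field.
rewrite -[LHS]mul1r -{1}P; ring.
Qed.

(** Homogeneity of the power: the substitution [y = k x] brings out [k^(eta - 3/2)], the rate that
    the theorem normalises. *)
Lemma integral_scaled k : 0 < k ->
  cmu.-integrable Rpos (EFin \o (fun x => x `^ (1 / 2 - eta) * W (k * x))) /\
  \int[cmu]_(x in Rpos) (x `^ (1 / 2 - eta) * W (k * x)) =
    k `^ (eta - 3 / 2) * \int[lmu]_(y in Rpos) w y.
Proof.
move=> k0; have Iw := integrable_besselW hmu heta.
have [Ik Ek] := halfline_scaleR k0 continuous_w Iw.
have I : lmu.-integrable Rpos (EFin \o (fun x => x `^ (1 / 2 - eta) * W (k * x))).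
  have I0 : lmu.-integrable Rpos (EFin \o (fun x => k `^ (eta - 3 / 2) * (k * w (k * x)))).
    exact: integrableZR.
  apply: eq_integrable I0 => //= x; rewrite inE/= in_itv/= andbT => x0.
  by rewrite -wscale.
split; first exact: integrable_completed.
rewrite Rintegral_completed; [|exact: measurable_itv|exact: I].
rewrite -Ek -RintegralZl; [|exact: measurable_itv|exact: Ik].
by apply: eq_Rintegral => x; rewrite inE/= in_itv/= andbT => x0; rewrite wscale.
Qed.

Lemma integral_scaled_norm k : 0 < k ->
  cmu.-integrable Rpos (EFin \o (fun x => x `^ (1 / 2 - eta) * `|W (k * x)|)) /\
  \int[cmu]_(x in Rpos) (x `^ (1 / 2 - eta) * `|W (k * x)|) =
    k `^ (eta - 3 / 2) * \int[lmu]_(y in Rpos) `|w y|.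
Proof.
move=> k0; have Iw := integrable_norm (integrable_besselW hmu heta).
have cw x : 0 < x -> {for x, continuous (fun x => `|w x|)}.
  by move=> x0; apply: cvg_norm; exact: continuous_w.
have [Ik Ek] := halfline_scaleR k0 cw Iw.
have E x : 0 < x -> x `^ (1 / 2 - eta) * `|W (k * x)| = k `^ (eta - 3 / 2) * (k * `|w (k * x)|).
  move=> x0; rewrite -{1}(ger0_norm (powR_ge0 x (1 / 2 - eta))) -normrM wscale//.
  by rewrite !normrM ger0_norm ?powR_ge0// (gtr0_norm k0).
have I : lmu.-integrable Rpos (EFin \o (fun x => x `^ (1 / 2 - eta) * `|W (k * x)|)).
  have I0 : lmu.-integrable Rpos (EFin \o (fun x => k `^ (eta - 3 / 2) * (k * `|w (k * x)|))).
    exact: integrableZR.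
  apply: eq_integrable I0 => //= x; rewrite inE/= in_itv/= andbT => x0.
  by rewrite -E.
split; first exact: integrable_completed.
rewrite Rintegral_completed; [|exact: measurable_itv|exact: I].
rewrite -Ek -RintegralZl; [|exact: measurable_itv|exact: Ik].
by apply: eq_Rintegral => x; rewrite inE/= in_itv/= andbT => x0; rewrite E.
Qed.

Definition slow_integrable u :=
  forall X, 0 < X -> cmu.-integrable (`]0, X[%classic : set R)
    (EFin \o (fun x => x `^ (mu + 1 / 2) * u x)).

(** Measurability is extracted from integrability on the intervals []0, n + 1[], then the positive
    weight is divided out. *)
Lemma slow_measurable u : slow_integrable u -> measurable_fun (Rpos : set cR) u.
Proof.
move=> hu.
have E : Rpos = \bigcup_n (`]0, n.+1%:R[%classic : set R).
  apply/seteqP; split => [x|x [n _]]/=; rewrite !in_itv/= ?andbT; last by case/andP.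
  move=> x0; exists (Num.truncn x) => //=; rewrite in_itv/= x0/=; exact: truncnS_gt.
have m1 : measurable_fun (Rpos : set cR) (fun x => x `^ (mu + 1 / 2) * u x).
  rewrite E; apply/measurable_fun_bigcup; first by move=> i; exact: measurable_itv_completed.
  by move=> n; apply: measurable_integrableR (hu n.+1%:R _).
have m2 : measurable_fun (Rpos : set cR) (fun x => x `^ (- (mu + 1 / 2)) : R).
  by apply: measurable_fun_completed => //; apply: measurable_funTS; exact: measurable_powR.
have := measurable_funM m2 m1; apply: eq_measurable_fun => x.
rewrite inE/= in_itv/= andbT => x0.
by rewrite /= mulrA -powRDpos// addNr powRr0 mul1r.
Qed.

(* Near 0 the bound [|W y| <= M y^(mu+1/2)] is used, near infinity the decay of [u]. *)
Lemma slow_bound : exists2 M, 0 < M & forall u X e k, slow_integrable u ->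
  0 < X -> 0 <= e -> (forall x, X <= x -> `|x `^ (eta - 1 / 2) * u x| <= e) -> 0 < k ->
  cmu.-integrable Rpos (EFin \o (fun x => W (k * x) * u x)) /\
  `|\int[cmu]_(x in Rpos) (W (k * x) * u x)| <=
    M * k `^ (mu + 1 / 2) * \int[cmu]_(x in (`]0, X[%classic : set R)) `|x `^ (mu + 1 / 2) * u x| +
    e * (k `^ (eta - 3 / 2) * \int[lmu]_(y in Rpos) `|w y|).
Proof.
have [M M0 HM] := besselW_bound hmu.
exists M => // u X e k hu X0 e0 ue k0.
pose A := (`]0, X[%classic : set R).
(* [p] carries the part of the bound living on []0, X[]; [q] is the model tail, kept on the whole
   half-line so that its integral scales exactly. *)
pose p x := \1_A x * `|x `^ (mu + 1 / 2) * u x|.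
pose q x := x `^ (1 / 2 - eta) * `|W (k * x)|.
have [Iq Eq] := integral_scaled_norm k0.
have IA := integrable_norm (hu _ X0).
have IpT : cmu.-integrable setT (EFin \o p).
  have := (integrable_mkcond _ (measurable_itv_completed _)).1 IA.
  apply: eq_integrable => // x _; rewrite patchE /p /= indicE.
  by case: ifP => _; rewrite ?mul1r ?mul0r.
have Ip : cmu.-integrable Rpos (EFin \o p).
  by apply: (integrableS _ _ _ IpT) => //; exact: measurable_Rpos_completed.
have Ep : \int[cmu]_(x in Rpos) p x = \int[cmu]_(x in A) `|x `^ (mu + 1 / 2) * u x|.
  rewrite [LHS]Rintegral_mkcond [RHS]Rintegral_mkcond; apply: eq_Rintegral => x _.
  rewrite !patchE /p indicE; case: ifPn => [_|xn]; first by case: ifP; rewrite ?mul1r ?mul0r.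
  rewrite ifF//; apply: contraNF xn; rewrite !inE/= !in_itv/= andbT.
  by case/andP.
have mW : measurable_fun (Rpos : set cR) (fun x => W (k * x)).
  apply: measurable_fun_completed => //; apply: halfline_continuous_measurable => x x0.
  apply: (@cvg_comp _ _ _ (fun y => k * y) W _ (nbhs (k * x))).
    by apply: cvgM; [exact: cvg_cst|exact: cvg_id].
  by apply: continuous_besselW => //; rewrite mulr_gt0.
have dom x : Rpos x -> `|W (k * x) * u x| <= M * k `^ (mu + 1 / 2) * p x + e * q x.
  rewrite /= in_itv/= andbT => x0; rewrite normrM.
  have kx0 : 0 < k * x by rewrite mulr_gt0.
  have [_ h2] := HM _ kx0.
  have p0 : 0 <= M * k `^ (mu + 1 / 2) * p x.
    by rewrite !mulr_ge0 ?powR_ge0 ?(ltW M0)// /p mulr_ge0// indicE ler0n.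
  have q0 : 0 <= e * q x by rewrite !mulr_ge0 ?powR_ge0.
  have [xX|xX] := ltP x X.
    apply: ler_wpDr => //; have xA : x \in A by rewrite inE /A /= in_itv/= x0.
    have -> : p x = x `^ (mu + 1 / 2) * `|u x|.
      by rewrite /p indicE xA [LHS]mul1r normrM (ger0_norm (powR_ge0 _ _)).
    by rewrite mulrA ler_wpM2r// -mulrA -powRM ?(ltW k0) ?(ltW x0).
  apply: ler_wpDl => //.
  (* Beyond [X] the hypothesis amounts to [|u x| <= e x^(1/2 - eta)]. *)
  have h := ue x xX; move: h; rewrite normrM (ger0_norm (powR_ge0 _ _)) => h.
  rewrite /q mulrA mulrC ler_wpM2r//.
  have P : x `^ (1 / 2 - eta) * x `^ (eta - 1 / 2) = 1.
    by rewrite -powRDpos// (_ : _ + _ = 0) ?powRr0//; field.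
  rewrite -[leLHS]mul1r -{1}P -mulrA mulrC ler_wpM2r ?powR_ge0//.
have Ig : cmu.-integrable Rpos (EFin \o (fun x => M * k `^ (mu + 1 / 2) * p x + e * q x)).
  by apply: integrableZD => //; exact: measurable_Rpos_completed.
have I : cmu.-integrable Rpos (EFin \o (fun x => W (k * x) * u x)).
  have mWu : measurable_fun (Rpos : set cR) (fun x => W (k * x) * u x).
    by apply: measurable_funM => //; exact: slow_measurable.
  exact: (le_integrableR measurable_Rpos_completed mWu dom Ig).
split=> //.
apply: (le_trans (le_normr_Rintegral measurable_Rpos_completed I)).
apply: (@le_trans _ _ (\int[cmu]_(x in Rpos) (M * k `^ (mu + 1 / 2) * p x + e * q x))).
  by apply: le_Rintegral => //; [exact: measurable_Rpos_completed|exact: integrable_norm].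
by rewrite RintegralZD//; [rewrite Ep Eq|exact: measurable_Rpos_completed].
Qed.

End RealLimit.

(** * The Abelian limit for real functions *)

Section RealAbelian.
Context {R : realType}.
Variables (mu eta : R) (hmu : - (1 / 2) <= mu) (heta : 3 / 2 < eta < mu + 2).
Implicit Types (u r : R -> R) (k x X l : R).
Local Notation Rpos := (`]0, +oo[%classic : set R).
Local Notation lmu := (@lebesgue_measure R).
Local Notation cmu := (@completed_lebesgue_measure R).
Local Notation W := (besselW mu).

Lemma slow_integrable_powR : slow_integrable mu (fun x => x `^ (1 / 2 - eta)).
Proof.
move=> X X0.
have /andP[e1 e2] := heta.
have I : lmu.-integrable (`]0, X[%classic : set R) (EFin \o (fun x => x `^ (mu + 1 - eta))).
  by apply: integrable_powR_left; lra.
have := integrable_completed (measurable_itv _) I.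
apply: eq_integrable; first exact: measurable_itv_completed.
move=> x; rewrite inE/= in_itv/= => /andP[x0 _].
by rewrite -powRDpos//; congr (_ `^ _)%:E; field.
Qed.

Lemma slow_integrable_lin u r (a b : R) : slow_integrable mu u -> slow_integrable mu r ->
  slow_integrable mu (fun x => a * u x + b * r x).
Proof.
move=> hu hr X X0.
have := integrableZD (measurable_itv_completed _) a b (hu X X0) (hr X X0).
apply: eq_integrable; first exact: measurable_itv_completed.
by move=> x _ /=; congr EFin; ring.
Qed.

Lemma integrable_besselW_slow u l k : slow_integrable mu u ->
  x `^ (eta - 1 / 2) * u x @[x --> +oo] --> l -> 0 < k ->
  cmu.-integrable Rpos (EFin \o (fun x => W (k * x) * u x)).
Proof.
move=> hu ul k0; have [M M0 H] := slow_bound hmu heta.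
have : \forall x \near +oo, `|l - x `^ (eta - 1 / 2) * u x| < 1.
  by move/cvgrPdist_lt : ul; apply.
move=> [X [Xr HX]].
have X0 : 0 < `|X| + 1 by rewrite ltr_wpDl.
have e0 : 0 <= `|l| + 1 by [].
have hX x : `|X| + 1 <= x -> `|x `^ (eta - 1 / 2) * u x| <= `|l| + 1.
  move=> xX; have Xx : X < x.
    by apply: lt_le_trans xX; rewrite (le_lt_trans (ler_norm X))// ltrDl.
  have /ltW h := HX x Xx.
  rewrite -[X in `|X|](subrK l) (le_trans (ler_normD _ _))// addrC lerD2l.
  by rewrite distrC.
by have [] := H u _ _ k hu X0 e0 hX k0.
Qed.

(** Fixing [X] far enough makes the tail cost at most [e / 2] for every [k]; the remaining head is a
    constant times [k^(mu + 2 - eta)], which vanishes with [k]. *)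
Lemma besselW_small r : slow_integrable mu r ->
  x `^ (eta - 1 / 2) * r x @[x --> +oo] --> 0 ->
  k `^ (3 / 2 - eta) * \int[cmu]_(x in Rpos) (W (k * x) * r x) @[k --> 0^'+] --> 0.
Proof.
move=> hr r0; have [M M0 H] := slow_bound hmu heta.
have /andP[e1 e2] := heta.
apply/cvgrPdist_lt => e e0.
pose A := \int[lmu]_(y in Rpos) `|y `^ (1 / 2 - eta) * W y|.
have A0 : 0 <= A by apply: Rintegral_ge0.
(* Adding 1 to [A] keeps the denominator positive. *)
have c0 : 0 < e / (2 * (A + 1)) by rewrite divr_gt0// mulr_gt0// ltr_wpDl.
have : \forall x \near +oo, `|0 - x `^ (eta - 1 / 2) * r x| < e / (2 * (A + 1)).
  by move/cvgrPdist_lt : r0; apply.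
move=> [X [Xr HX]].
have X0 : 0 < `|X| + 1 by rewrite ltr_wpDl.
have hX x : `|X| + 1 <= x -> `|x `^ (eta - 1 / 2) * r x| <= e / (2 * (A + 1)).
  move=> xX; have Xx : X < x.
    by apply: lt_le_trans xX; rewrite (le_lt_trans (ler_norm X))// ltrDl.
  by have /ltW := HX x Xx; rewrite sub0r normrN.
pose B := \int[cmu]_(x in (`]0, `|X| + 1[%classic : set R)) `|x `^ (mu + 1 / 2) * r x|.
have B0 : 0 <= B by apply: Rintegral_ge0.
have L : M * B * k `^ (mu + 2 - eta) @[k --> 0^'+] --> 0.
  rewrite -[X in _ --> X](mulr0 (M * B)); apply: cvgM; first exact: cvg_cst.
  by apply: powR_cvg0; lra.
have L2 : \forall k \near 0^'+, `|0 - M * B * k `^ (mu + 2 - eta)| < e / 2.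
  by move/cvgrPdist_lt : L; apply; rewrite divr_gt0.
near=> k.
have k0 : 0 < k by near: k; exact: nbhs_right_gt.
have hk : `|0 - M * B * k `^ (mu + 2 - eta)| < e / 2 by near: k.
have [_ h] := H r _ _ k hr X0 (ltW c0) hX k0.
rewrite sub0r normrN normrM (ger0_norm (powR_ge0 _ _)).
have h2 : k `^ (3 / 2 - eta) * `|\int[cmu]_(x in Rpos) (W (k * x) * r x)| <=
   M * B * k `^ (mu + 2 - eta) + e / (2 * (A + 1)) * A.
  apply: (le_trans (ler_wpM2l (powR_ge0 _ _) h)); rewrite -/A -/B.
  have P1 : k `^ (3 / 2 - eta) * k `^ (mu + 1 / 2) = k `^ (mu + 2 - eta).
    by rewrite -powRDpos//; congr (_ `^ _); field.
  have P2 : k `^ (3 / 2 - eta) * k `^ (eta - 3 / 2) = 1.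
    by rewrite -powRDpos// (_ : _ + _ = 0) ?powRr0//; field.
  rewrite mulrDr lerD//.
    by rewrite -P1 (_ : _ * (_ * _ * _) = M * B * (k `^ (3 / 2 - eta) * k `^ (mu + 1 / 2)))//; ring.
  rewrite (_ : _ * (_ * (_ * _)) = e / (2 * (A + 1)) * A * (k `^ (3 / 2 - eta) * k `^ (eta - 3 / 2))).
    by rewrite P2 mulr1.
  ring.
apply: (le_lt_trans h2).
have h3 : M * B * k `^ (mu + 2 - eta) < e / 2.
  by move: hk; rewrite sub0r normrN; apply: le_lt_trans; exact: ler_norm.
have h4 : e / (2 * (A + 1)) * A <= e / 2.
  rewrite invfM -!mulrA ler_pM2l// -[leRHS]mulr1 ler_wpM2l// ?invr_ge0// mulrC.
  by rewrite ler_pdivrMr ?ltr_wpDl// mul1r lerDl.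
by rewrite [ltRHS]splitr ltr_leD.
Unshelve. all: by end_near. Qed.

Lemma besselW_abelian u l : slow_integrable mu u ->
  x `^ (eta - 1 / 2) * u x @[x --> +oo] --> l ->
  k `^ (3 / 2 - eta) * \int[cmu]_(x in Rpos) (W (k * x) * u x) @[k --> 0^'+]
    --> l * (2 `^ mu * Hconst mu eta).
Proof.
(* The remainder is written as a linear combination with explicit coefficient 1 to fit the linearity
   lemmas. *)
move=> hu ul; pose r x := 1 * u x + (- l) * x `^ (1 / 2 - eta).
have hr : slow_integrable mu r by apply: slow_integrable_lin => //; exact: slow_integrable_powR.
have r0 : x `^ (eta - 1 / 2) * r x @[x --> +oo] --> 0.
  have ul0 : x `^ (eta - 1 / 2) * u x - l @[x --> +oo] --> 0.
    by rewrite -(subrr l); apply: cvgB => //; exact: cvg_cst.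
  apply: cvg_trans ul0; apply: near_eq_cvg; near=> x.
  have x0 : 0 < x by near: x; exact: nbhs_pinfty_gt.
  have P : x `^ (eta - 1 / 2) * x `^ (1 / 2 - eta) = 1.
    by rewrite -powRDpos// (_ : _ + _ = 0) ?powRr0//; field.
  suff -> : x `^ (eta - 1 / 2) * r x = x `^ (eta - 1 / 2) * u x - l by [].
  transitivity (x `^ (eta - 1 / 2) * u x -
      l * (x `^ (eta - 1 / 2) * x `^ (1 / 2 - eta))); last by rewrite P mulr1.
  rewrite /r.
  by move: (x `^ (eta - 1 / 2)) (x `^ (1 / 2 - eta)) => a b; ring.
have S := besselW_small hr r0.
rewrite -[X in _ --> X]add0r.
have S2 : k `^ (3 / 2 - eta) * \int[cmu]_(x in Rpos) (W (k * x) * r x) +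
    l * (2 `^ mu * Hconst mu eta) @[k --> 0^'+] --> 0 + l * (2 `^ mu * Hconst mu eta).
  by apply: cvgD => //; exact: cvg_cst.
apply: cvg_trans S2; apply: near_eq_cvg; near=> k.
have k0 : 0 < k by near: k; exact: nbhs_right_gt.
have [I1 E1] := integral_scaled hmu heta k0.
have Iu := integrable_besselW_slow hu ul k0.
have -> : \int[cmu]_(x in Rpos) (W (k * x) * r x) =
   1 * \int[cmu]_(x in Rpos) (W (k * x) * u x) +
   - l * \int[cmu]_(x in Rpos) (x `^ (1 / 2 - eta) * W (k * x)).
  rewrite -RintegralZD//; last exact: measurable_Rpos_completed.
  by apply: eq_Rintegral => x _; rewrite /r; move: (W _) => v; ring.
rewrite E1 integral_besselW//.
have P2 : k `^ (3 / 2 - eta) * k `^ (eta - 3 / 2) = 1.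
  by rewrite -powRDpos// (_ : _ + _ = 0) ?powRr0//; field.
move: (Rintegral _ _ _) (2 `^ mu) (Hconst mu eta) P2 => I a b P2.
rewrite mulrDr mul1r (_ : k `^ (3 / 2 - eta) * (- l * _) =
   - (k `^ (3 / 2 - eta) * k `^ (eta - 3 / 2)) * (l * (a * b))); last by ring.
by rewrite P2 mulN1r subrK.
Unshelve. all: by end_near. Qed.

End RealAbelian.

(** * Smoothness in [x] with bounds uniform in a parameter *)

Section UniformlySmooth.
Context {R : realType}.
Implicit Types (F G : R -> R -> R) (f g : R -> R) (n k : nat) (s x c p mu : R).

Local Notation D1 := (@derive1 R R).

(** The parameter [s] will be the transform variable near 0; uniformity in it is what turns
    continuity of a distribution into a bound independent of the variable. *)
Definition locally_bounded F := forall a b : R, 0 < a ->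
  exists M : R, forall s x, 0 < s <= 1 -> a <= x <= b -> `|F s x| <= M.

(* Derivatives in [x], not in the parameter [s], of order at most [n]. *)
Fixpoint unif_smooth n F : Prop :=
  locally_bounded F /\
  if n is n'.+1 then exists2 F', (forall s x, 0 < s <= 1 -> 0 < x -> is_derive x 1 (F s) (F' s x)) &
    unif_smooth n' F'
  else True.

Lemma unif_smoothW n F : unif_smooth n.+1 F -> unif_smooth n F.
Proof.
elim: n F => [|n IH] F [bF [F' dF uF']]; split=> //.
by exists F' => //; exact: IH.
Qed.

Lemma eq_locally_bounded F G : (forall s x, 0 < s <= 1 -> 0 < x -> F s x = G s x) ->
  locally_bounded F -> locally_bounded G.
Proof.
move=> FG bF a b a0; have [M HM] := bF a b a0; exists M => s x s01 xab.
rewrite -FG//; first exact: HM.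
by case/andP: xab => + _; exact: lt_le_trans.
Qed.

Lemma is_derive_eq_pos f g x c : (forall y, 0 < y -> f y = g y) -> 0 < x ->
  is_derive x 1 f c -> is_derive x 1 g c.
Proof.
move=> fg x0; apply: near_eq_is_derive; near=> y; apply: fg.
by near: y; exact: lt_nbhsr.
Unshelve. all: by end_near. Qed.

Lemma eq_unif_smooth n F G : (forall s x, 0 < s <= 1 -> 0 < x -> F s x = G s x) ->
  unif_smooth n F -> unif_smooth n G.
Proof.
case: n => [|n] FG [bF h]; split=> //; try exact: eq_locally_bounded bF.
case: h => F' dF uF'; exists F' => // s x s01 x0.
by apply: is_derive_eq_pos (dF s x s01 x0) => // y y0; exact: FG.
Qed.

Lemma locally_boundedD F G : locally_bounded F -> locally_bounded G ->
  locally_bounded (fun s x => F s x + G s x).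
Proof.
move=> bF bG a b a0; have [M HM] := bF a b a0; have [N HN] := bG a b a0.
exists (M + N) => s x s01 xab; rewrite (le_trans (ler_normD _ _))//.
by rewrite lerD// ?HM ?HN.
Qed.

Lemma locally_boundedM F G : locally_bounded F -> locally_bounded G ->
  locally_bounded (fun s x => F s x * G s x).
Proof.
move=> bF bG a b a0; have [M HM] := bF a b a0; have [N HN] := bG a b a0.
exists (M * N) => s x s01 xab; rewrite normrM ler_pM//.
- exact: HM.
- exact: HN.
Qed.

Lemma unif_smoothD n F G : unif_smooth n F -> unif_smooth n G ->
  unif_smooth n (fun s x => F s x + G s x).
Proof.
elim: n F G => [|n IH] F G [bF hF] [bG hG]; split=> //; try exact: locally_boundedD.
case: hF hG => F' dF uF [G' dG uG]; exists (fun s x => F' s x + G' s x); last exact: IH.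
by move=> s x s01 x0; apply: is_deriveD_fun; [exact: dF|exact: dG].
Qed.

Lemma unif_smoothM n F G : unif_smooth n F -> unif_smooth n G ->
  unif_smooth n (fun s x => F s x * G s x).
Proof.
elim: n F G => [|n IH] F G uF uG.
  by case: uF uG => bF _ [bG _]; split=> //; exact: locally_boundedM.
(* The product rule pairs a derivative, smooth to order [n], with an undifferentiated factor, which
   is lowered to the same order. *)
have uF0 := unif_smoothW uF; have uG0 := unif_smoothW uG.
case: uF uG => bF [F' dF uF] [bG [G' dG uG]]; split; first exact: locally_boundedM.
exists (fun s x => F' s x * G s x + F s x * G' s x).
  by move=> s x s01 x0; apply: is_deriveM_fun; [exact: dF|exact: dG].
by apply: unif_smoothD; exact: IH.
Qed.

Lemma unif_smooth_cst n (C : R -> R) (M : R) : (forall s, 0 < s <= 1 -> `|C s| <= M) ->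
  unif_smooth n (fun s _ => C s).
Proof.
elim: n C M => [|n IH] C M HC; split=> //; try by move=> a b _; exists M => s x /HC.
exists (fun _ _ => 0).
  by move=> s x _ _; exact: is_derive_cst.
by apply: (IH (fun=> 0) 0) => s _; rewrite normr0.
Qed.

Lemma unif_smooth_id n : unif_smooth n (fun _ x => x).
Proof.
have b : locally_bounded (fun _ x => x).
  move=> a b a0; exists b => s x _ /andP[ax xb].
  by rewrite gtr0_norm// (lt_le_trans a0).
case: n => [|n]; split=> //; exists (fun _ _ => 1).
  by move=> s x _ _; exact: is_derive_id.
by apply: (@unif_smooth_cst n (fun=> 1) 1) => s _; rewrite normr1.
Qed.

(** The direction of monotonicity depends on the sign of [p]; the sum of the two end values covers
    both cases. *)
Lemma locally_bounded_powR p : locally_bounded (fun _ x => x `^ p).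
Proof.
move=> a b a0; exists (a `^ p + b `^ p) => s x _ /andP[ax xb].
have x0 := lt_le_trans a0 ax; rewrite ger0_norm ?powR_ge0//.
have [p0|p0] := leP 0 p.
  by rewrite ler_wpDl ?powR_ge0// ge0_ler_powR// nnegrE ltW// (lt_le_trans x0).
rewrite ler_wpDr ?powR_ge0// -[p]opprK !(powRN _ (- p)) lef_pV2 ?posrE ?powR_gt0//.
by rewrite ge0_ler_powR ?nnegrE ?(ltW a0) ?(ltW x0)// oppr_ge0 ltW.
Qed.

Lemma unif_smooth_powR n p : unif_smooth n (fun _ x => x `^ p).
Proof.
have b := locally_bounded_powR; elim: n p => [|n IH] p; first by split.
split=> //; exists (fun _ x => p * x `^ (p - 1)).
  by move=> s x _ x0; exact: is_derive1_powR.
by apply: unif_smoothM; [apply: (@unif_smooth_cst n (fun=> p) `|p|)|exact: IH].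
Qed.

(** Sine and cosine are treated together because each is the derivative of the other, up to sign and
    a linear factor. *)
Lemma unif_smooth_trig n c :
  unif_smooth n (fun _ x => cos (c * x ^+ 2)) /\ unif_smooth n (fun _ x => sin (c * x ^+ 2)).
Proof.
have bc : locally_bounded (fun _ x => cos (c * x ^+ 2)).
  move=> a b a0; exists 1 => s x _ _; rewrite ler_norml.
  by rewrite cos_geN1 cos_le1.
have bs : locally_bounded (fun _ x => sin (c * x ^+ 2)).
  move=> a b a0; exists 1 => s x _ _; rewrite ler_norml.
  by rewrite sin_geN1 sin_le1.
elim: n => [|n [IHc IHs]]; first by [].
have d0 x : is_derive x 1 (fun y => c * y ^+ 2) (2 * c * x).
  apply: (is_derive_eq (is_deriveM_fun (is_derive_cst c x 1) (is_derive_sqr x))).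
  by rewrite mul0r add0r mulrCA mulrA.
have ul p : unif_smooth n (fun _ x => p * x).
  by apply: unif_smoothM; [apply: (@unif_smooth_cst n (fun=> p) `|p|)|exact: unif_smooth_id].
split; split=> //.
- exists (fun _ x => sin (c * x ^+ 2) * (- 2 * c * x)); last exact: unif_smoothM.
  move=> s x _ _; apply: (is_derive_eq (@is_derive_comp_fun _ cos _ x _ _ (is_derive_cos _) (d0 x))).
  by ring.
- exists (fun _ x => cos (c * x ^+ 2) * (2 * c * x)); last exact: unif_smoothM.
  move=> s x _ _; exact: (@is_derive_comp_fun _ sin _ x _ _ (is_derive_sin _) (d0 x)).
Qed.

Lemma locally_bounded_besselE mu c : -1 < mu ->
  locally_bounded (fun s x => besselE mu ((s * c * x) ^+ 2 / 4)).
Proof.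
move=> mu1 a b a0; exists ((expR (-2) / 2)^-1 * expR ((c * b) ^+ 2 / 4)).
move=> s x /andP[s0 s1] /andP[ax xb]; have x0 := lt_le_trans a0 ax.
apply: le_trans (besselE_bound _ mu1) _.
rewrite ler_wpM2l ?invr_ge0 ?divr_ge0 ?expR_ge0// ler_expR.
rewrite ger0_norm ?divr_ge0 ?sqr_ge0// ler_wpM2r//.
rewrite -(real_normK (num_real (s * c * x))) -(real_normK (num_real (c * b))) ler_sqr ?nnegrE//.
rewrite -mulrA normrM (gtr0_norm s0) -[leRHS]mul1r ler_pM ?(ltW s0)// !normrM.
by rewrite ler_wpM2l// !gtr0_norm// (lt_le_trans x0).
Qed.

(** The order is generalised in the induction since differentiation raises it. The chain rule
    contributes factors [s c], bounded because [s <= 1]. *)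
Lemma unif_smooth_besselE n mu c : -1 < mu ->
  unif_smooth n (fun s x => besselE mu ((s * c * x) ^+ 2 / 4)).
Proof.
have bd := locally_bounded_besselE; elim: n mu => [|n IH] mu mu1; first by split; first exact: bd.
split; first exact: bd.
exists (fun s x => s * c * (- (s * c * x / 2)) * besselE (mu + 1) ((s * c * x) ^+ 2 / 4)).
  move=> s x _ _.
  have d0 : is_derive x 1 (fun y => s * c * y) (s * c).
    apply: (is_derive_eq (is_deriveM_fun (is_derive_cst (s * c) x 1) (is_derive_id x 1))).
    by rewrite mul0r add0r mulr1.
  have := @is_derive_comp_fun _ _ (fun y => s * c * y) x _ _ (is_derive_besselE_sqr (s * c * x) mu1) d0.
  by move/is_derive_eq; apply; rewrite mulrC mulrA.
have us : unif_smooth n (fun s _ => s * c).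
  apply: (@unif_smooth_cst n (fun s => s * c) `|c|) => s /andP[s0 s1].
  by rewrite normrM ler_piMl// gtr0_norm.
apply: unif_smoothM; last by apply: IH; lra.
apply: unif_smoothM => //.
apply: (@eq_unif_smooth _ (fun s x => s * c * x * (- 2^-1))).
  by move=> s x _ _; rewrite mulrN.
apply: unif_smoothM; last by apply: (@unif_smooth_cst n (fun=> - 2^-1) `|- 2^-1|).
by apply: unif_smoothM => //; exact: unif_smooth_id.
Qed.

Lemma eq_iter_derive1 n f g x : (forall y, 0 < y -> f y = g y) -> 0 < x ->
  iter n D1 f x = iter n D1 g x.
Proof.
elim: n f g => [|n IH] f g fg x0; first exact: fg.
rewrite !iterSr; apply: IH => // y y0; rewrite !derive1E.
apply: near_eq_derive; near=> z; apply: fg.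
by near: z; exact: lt_nbhsr.
Unshelve. all: by end_near. Qed.

Lemma unif_smooth_derivable n F s x : unif_smooth n.+1 F -> 0 < s <= 1 -> 0 < x ->
  derivable (iter n D1 (F s)) x 1.
Proof.
elim: n F => [|n IH] F [_ [F' dF uF']] s01 x0; first by have [] := dF s x s01 x0.
rewrite iterSr; apply: near_eq_derivable (IH F' uF' s01 x0).
near=> y; have y0 : 0 < y by near: y; exact: lt_nbhsr.
apply: eq_iter_derive1 => // z z0; rewrite derive1E.
by have [_ ->] := dF s z s01 z0.
Unshelve. all: by end_near. Qed.

(** The multiple [c] is kept inside the derivatives so that rescaled families are covered
    directly. *)
Lemma unif_smooth_iter_bound n F (a b : R) : unif_smooth n F -> 0 < a ->
  exists M, forall s c k x, 0 < s <= 1 -> (k <= n)%N -> a <= x <= b ->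
    `|iter k D1 (fun y => c * F s y) x| <= `|c| * M.
Proof.
move=> + a0; elim: n F => [|n IH] F [bF h].
  have [M HM] := bF a b a0; exists M => s c k x s01; rewrite leqn0 => /eqP -> xab.
  by rewrite /= normrM ler_wpM2l// HM.
have [M HM] := bF a b a0; case: h => F' dF /IH[N HN].
exists (Num.max M N) => s c [|k] x s01 kn xab.
  by rewrite /= normrM ler_wpM2l// le_max HM.
have x0 : 0 < x by case/andP: xab => + _; exact: lt_le_trans.
rewrite iterSr (@eq_iter_derive1 _ _ (fun y => c * F' s y))//.
  by rewrite (le_trans (HN _ _ _ _ s01 kn xab))// ler_wpM2l// le_max lexx orbT.
move=> y y0; rewrite derive1E.
have [_ ->] := is_deriveM_fun (is_derive_cst c y 1) (dF s y s01 y0).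
by rewrite mul0r add0r.
Qed.

End UniformlySmooth.

(** * Complex limits through real moduli and coordinates *)

Section ComplexLimits.
Context {R : realType}.
Implicit Types (z a : R[i]) (r : R).
Local Open Scope complex_scope.

Lemma Re_realM r z : complex.Re (r%:C * z) = r * complex.Re z.
Proof. by case: z => b d /=; rewrite mul0r subr0. Qed.

Lemma Im_realM r z : complex.Im (r%:C * z) = r * complex.Im z.
Proof. by case: z => b d /=; rewrite mul0r addr0. Qed.

Lemma normc_ge0 z : 0 <= Normc.normc z.
Proof. by case: z => a b; exact: sqrtr_ge0. Qed.

Lemma Re_le_normc z : `|complex.Re z| <= Normc.normc z.
Proof. by case: z => a b /=; rewrite -sqrtr_sqr ler_wsqrtr// lerDl sqr_ge0. Qed.

Lemma Im_le_normc z : `|complex.Im z| <= Normc.normc z.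
Proof. by case: z => a b /=; rewrite -sqrtr_sqr ler_wsqrtr// lerDr sqr_ge0. Qed.

Lemma normc_le z : Normc.normc z <= `|complex.Re z| + `|complex.Im z|.
Proof.
case: z => a b /=; rewrite -[leRHS]ger0_norm ?addr_ge0// -sqrtr_sqr ler_wsqrtr//.
rewrite sqrrD !real_normK ?num_real// -addrA lerD2l lerDr.
by rewrite mulrn_wge0// mulr_ge0.
Qed.

Lemma normc_real r : Normc.normc r%:C = `|r|.
Proof. by rewrite /= expr0n/= addr0 sqrtr_sqr. Qed.

Lemma normc_expi r : Normc.normc (expi r) = 1.
Proof. by rewrite /= cos2Dsin2 sqrtr1. Qed.

Lemma expiD r (s : R) : expi (r + s) = expi r * expi s.
Proof. by rewrite /expi cosD sinD; apply/eqP; rewrite eq_complex/= addrC (addrC (sin r * _)) ?eqxx. Qed.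

(** The norm of [R[i]] takes values in [R[i]] itself; a positive tolerance there has zero imaginary
    part, so real tolerances suffice. *)
Lemma cvg_normcP (T : Type) (F : set_system T) {FF : Filter F} (f : T -> R[i]) z :
  ((f x : R[i]^o) @[x --> F] --> (z : R[i]^o)) <->
  (forall e : R, 0 < e -> \forall x \near F, Normc.normc (z - f x) < e).
Proof.
split=> [/cvgrPdist_lt h e e0|h].
  have e0c : 0 < e%:C :> R[i] by rewrite ltcR.
  by have := h _ e0c; apply: filterS => x; rewrite normc_def/= ltcR; case: (z - f x).
apply/cvgrPdist_lt => e e0.
have [r r0 ->] : exists2 r : R, 0 < r & e = r%:C.
  move: e0; case: e => a b; rewrite ltcE/= => /andP[/eqP -> a0].
  by exists a.
by have := h r r0; apply: filterS => x; rewrite normc_def/= ltcR; case: (z - f x).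
Qed.

Lemma cvg_Re (T : Type) (F : set_system T) {FF : Filter F} (f : T -> R[i]) z :
  ((f x : R[i]^o) @[x --> F] --> (z : R[i]^o)) ->
  complex.Re (f x) @[x --> F] --> complex.Re z.
Proof.
move=> /cvg_normcP h; apply/cvgrPdist_lt => e /h; apply: filterS => x; apply: le_lt_trans.
by apply: le_trans (Re_le_normc _); case: (f x) => a b; case: z {h} => c d.
Qed.

Lemma cvg_Im (T : Type) (F : set_system T) {FF : Filter F} (f : T -> R[i]) z :
  ((f x : R[i]^o) @[x --> F] --> (z : R[i]^o)) ->
  complex.Im (f x) @[x --> F] --> complex.Im z.
Proof.
move=> /cvg_normcP h; apply/cvgrPdist_lt => e /h; apply: filterS => x; apply: le_lt_trans.
by apply: le_trans (Im_le_normc _); case: (f x) => a b; case: z {h} => c d.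
Qed.

Lemma cvg_complex (T : Type) (F : set_system T) {FF : Filter F} (f g : T -> R) (a b : R) :
  f x @[x --> F] --> a -> g x @[x --> F] --> b ->
  ((f x +i* g x : R[i]^o) @[x --> F] --> (a +i* b : R[i]^o)).
Proof.
move=> /cvgrPdist_lt fa /cvgrPdist_lt gb; apply/cvg_normcP => e e0.
have e2 : 0 < e / 2 by rewrite divr_gt0.
near=> x; apply: (le_lt_trans (normc_le _)); rewrite /= (splitr e) ltrD//.
- by near: x; exact: fa.
- by near: x; exact: gb.
Unshelve. all: by end_near. Qed.

Lemma cvg_complexZl (T : Type) (F : set_system T) {FF : Filter F} (f : T -> R[i]) a z :
  ((f x : R[i]^o) @[x --> F] --> (z : R[i]^o)) ->
  ((a * f x : R[i]^o) @[x --> F] --> (a * z : R[i]^o)).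
Proof.
move=> /cvg_normcP h; apply/cvg_normcP => e e0.
have a0 : 0 < Normc.normc a + 1 by rewrite ltr_wpDl// normc_ge0.
have d0 : 0 < e / (Normc.normc a + 1) by rewrite divr_gt0.
apply: filterS (h _ d0) => x hx; rewrite -mulrBr Normc.normcM.
move: hx; rewrite ltr_pdivlMr// mulrC; apply: le_lt_trans.
by rewrite ler_wpM2r ?normc_ge0// lerDl.
Qed.

End ComplexLimits.

(** * Boundedness of compactly supported distributions on uniformly smooth families *)

Section CompactDistribution.
Context {R : realType}.
Implicit Types (P : R -> R -> R[i]) (F phi : R -> R[i]) (h : (R -> R[i]) -> R[i]).
Local Open Scope complex_scope.
Local Notation D1 := (@derive1 R R).

Lemma Re_iter_cderive n F x :
  complex.Re (iter n cderive F x) = iter n D1 (fun y => complex.Re (F y)) x.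
Proof.
elim: n x => [//|n IH] x; rewrite !iterS /cderive/=.
by congr (D1 _ x); apply/funext => y; exact: IH.
Qed.

Lemma Im_iter_cderive n F x :
  complex.Im (iter n cderive F x) = iter n D1 (fun y => complex.Im (F y)) x.
Proof.
elim: n x => [//|n IH] x; rewrite !iterS /cderive/=.
by congr (D1 _ x); apply/funext => y; exact: IH.
Qed.

Definition unif_smoothC P := forall n,
  unif_smooth n (fun s x => complex.Re (P s x)) /\ unif_smooth n (fun s x => complex.Im (P s x)).

Lemma unif_smoothC_smooth P s : unif_smoothC P -> 0 < s <= 1 -> smooth_on_Rplus (P s).
Proof.
move=> uP s01 n x x0; have [uR uI] := uP n.+1.
have eR : (fun y => complex.Re (iter n cderive (P s) y)) = iter n D1 (fun y => complex.Re (P s y)).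
  by apply/funext => y; exact: Re_iter_cderive.
have eI : (fun y => complex.Im (iter n cderive (P s) y)) = iter n D1 (fun y => complex.Im (P s y)).
  by apply/funext => y; exact: Im_iter_cderive.
by rewrite eR eI; split; [exact: (unif_smooth_derivable uR)|exact: (unif_smooth_derivable uI)].
Qed.

Lemma smooth_on_Rplus0 : smooth_on_Rplus (fun=> 0 : R[i]).
Proof.
have u : unif_smoothC (fun _ _ => 0).
  by move=> n; split; apply: (@unif_smooth_cst _ n (fun=> 0) 0) => s _; rewrite normr0.
by apply: (@unif_smoothC_smooth (fun _ _ => 0) 1); rewrite // ltr01 lexx.
Qed.

Lemma compact_pos_sub_itv (K : set R) : compact K -> K `<=` `]0, +oo[ ->
  exists a b, 0 < a /\ forall x, K x -> a <= x <= b.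
Proof.
move=> cK K0; have [->|/set0P K1] := eqVneq K set0.
  by exists 1, 1; split.
have cid : {within K, continuous (id : R -> R)} by apply: continuous_subspaceT => x; exact: cvg_id.
have [a Ka ha] := compact_EVT_min K1 cK cid.
have [b Kb hb] := compact_EVT_max K1 cK cid.
exists a, b; split; first by move: Ka; rewrite inE => /K0/=; rewrite in_itv/= andbT.
by move=> x Kx; rewrite ha ?hb// inE.
Qed.

Lemma compact_distribution0 h : compact_distribution h -> h (fun=> 0) = 0.
Proof.
move=> [hl _].
have s0 := smooth_on_Rplus0.
have := hl 1 _ _ s0 s0.
rewrite (_ : (fun x => _) = (fun=> 0)); last by apply/funext => x; rewrite mulr0 addr0.
by rewrite mul1r => /(congr1 (fun z => z - h (fun=> 0))); rewrite addrK subrr => <-.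
Qed.

Lemma compact_distributionZ h phi (a : R[i]) : compact_distribution h ->
  smooth_on_Rplus phi -> h (fun x => a * phi x) = a * h phi.
Proof.
move=> hh sphi; have h0 := compact_distribution0 hh.
have s0 := smooth_on_Rplus0.
have [hl _] := hh; have := hl a _ _ sphi s0.
by rewrite h0 addr0 => <-; congr h; apply/funext => x; rewrite addr0.
Qed.

(** Continuity at 0 with tolerance 1 yields a neighbourhood; one factor [t] scales the whole family
    into it, and homogeneity turns this into the bound [1 / t]. *)
Lemma compact_distribution_bounded h P : compact_distribution h -> unif_smoothC P ->
  exists B, forall s, 0 < s <= 1 -> Normc.normc (h (P s)) <= B.
Proof.
move=> hh uP.
have s0 := smooth_on_Rplus0.
have [_ hc] := hh; have [K [n [d [cK K0 d0 Hd]]]] := hc _ s0 1 ltr01.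
have [a [b [a0 Kab]]] := compact_pos_sub_itv cK K0.
have [uR uI] := uP n.
have [M HM] := unif_smooth_iter_bound b uR a0.
have [N HN] := unif_smooth_iter_bound b uI a0.
(* The modulus is estimated by the sum of the two coordinates; the extra 1 gives positivity and a
   strict inequality. *)
pose t := d / (`|M| + `|N| + 1).
have q0 : 0 < `|M| + `|N| + 1 by rewrite ltr_wpDl// addr_ge0.
have t0 : 0 < t by rewrite divr_gt0.
exists t^-1 => s s01.
have sP : smooth_on_Rplus (P s) by exact: unif_smoothC_smooth.
have usc : unif_smoothC (fun s x => t%:C * P s x).
  move=> m; have [mR mI] := uP m.
  split; [apply: (@eq_unif_smooth _ _ (fun s x => t * complex.Re (P s x)))|
          apply: (@eq_unif_smooth _ _ (fun s x => t * complex.Im (P s x)))].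
  - by move=> ? ? _ _; rewrite Re_realM.
  - by apply: unif_smoothM => //; apply: (@unif_smooth_cst _ m (fun=> t) `|t|).
  - by move=> ? ? _ _; rewrite Im_realM.
  - by apply: unif_smoothM => //; apply: (@unif_smooth_cst _ m (fun=> t) `|t|).
have stP : smooth_on_Rplus (fun x => t%:C * P s x) by exact: (unif_smoothC_smooth usc s01).
have := Hd _ stP; rewrite (compact_distribution0 hh) subr0 compact_distributionZ//.
have small k x : (k <= n)%N -> K x ->
    Normc.normc (iter k cderive (fun y => t%:C * P s y - 0) x) < d.
  move=> kn /Kab xab; apply: (le_lt_trans (normc_le _)).
  rewrite Re_iter_cderive Im_iter_cderive.
  have -> : (fun y => complex.Re (t%:C * P s y - 0)) = (fun y => t * complex.Re (P s y)).
    by apply/funext => y; rewrite subr0 Re_realM.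
  have -> : (fun y => complex.Im (t%:C * P s y - 0)) = (fun y => t * complex.Im (P s y)).
    by apply/funext => y; rewrite subr0 Im_realM.
  apply: (@le_lt_trans _ _ (t * (`|M| + `|N|))).
    rewrite mulrDr lerD//.
      apply: (le_trans (HM s t k x s01 kn xab)).
      by rewrite (gtr0_norm t0) ler_pM2l// ler_norm.
    apply: (le_trans (HN s t k x s01 kn xab)).
    by rewrite (gtr0_norm t0) ler_pM2l// ler_norm.
  by rewrite /t mulrAC ltr_pdivrMr// ltr_pM2l// ltrDl.
move/(_ small) => h1; have := h1; rewrite Normc.normcM normc_real (gtr0_norm t0).
by rewrite -ltr_pdivlMl// mulr1 => /ltW.
Qed.

End CompactDistribution.

(** * Factorisation of the kernel and the two contributions to the limit *)

Section FractionalHankelAbelian.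
Context {R : realType}.
Variables (mu alpha eta : R) (hmu : - (1 / 2) <= mu) (halpha : 0 < alpha < pi).
Variable heta : 3 / 2 < eta < mu + 2.
Implicit Types (x xi k : R) (g : R -> R[i]) (h : (R -> R[i]) -> R[i]).
Local Open Scope complex_scope.
Local Notation Rpos := (`]0, +oo[%classic : set R).
Local Notation cmu := (@completed_lebesgue_measure R).
Local Notation cR := (caratheodory_type (wlength (@idfun R))^*%mu).
Local Notation W := (besselW mu).
Local Notation c := (cosec alpha).
Local Notation C := (frht_const alpha mu).

Let mu1 : -1 < mu. Proof. by move: hmu; lra. Qed.

Lemma sin_alpha_gt0 : 0 < sin alpha.
Proof. by apply: sin_gt0_pi. Qed.

Lemma cosec_gt0 : 0 < c.
Proof. by rewrite invr_gt0 sin_alpha_gt0. Qed.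

Lemma frht_const_neq0 : C != 0.
Proof.
apply: mulf_neq0.
  by apply/eqP => /(congr1 (@Normc.normc R)); rewrite normc_expi Normc.normc0 => /eqP; rewrite oner_eq0.
by rewrite invr_eq0 eq_complex/= negb_and gt_eqF// sin_alpha_gt0.
Qed.

Definition chirp x : R[i] := expi (- (x ^+ 2 * cotan alpha / 2)).

Lemma chirp_normalizer xi : expi (xi ^+ 2 * cotan alpha / 2) * chirp xi = 1.
Proof. by rewrite /chirp -expiD subrr /expi cos0 sin0. Qed.

Lemma frht_kernelE x xi : 0 < x -> 0 < xi -> frht_kernel mu alpha x xi =
  C * chirp xi * (2 `^ (- mu))%:C * ((W (xi * c * x))%:C * chirp x).
Proof.
move=> x0 xi0; have y0 : 0 < x * xi * c by rewrite !mulr_gt0// cosec_gt0.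
rewrite /frht_kernel sqrt_besselJ// rmorphM/= (_ : x * xi * c = xi * c * x); last by ring.
have -> : expi (- ((x ^+ 2 + xi ^+ 2) / 2 * cotan alpha)) = chirp xi * chirp x.
  by rewrite /chirp -expiD; congr expi; field.
by move: (chirp xi) (chirp x) (2 `^ _)%:C (W _)%:C => a b d e; ring.
Qed.

(** The kernel is 0 for [x <= 0], where the square root has a nonpositive argument. With value 0
    there, the factorisation is an equality of total functions and can be rewritten under [h]. *)
Definition frht_profile xi x : R[i] :=
  if 0 < x then (x `^ (mu + 1 / 2) * besselE mu ((xi * c * x) ^+ 2 / 4))%:C * chirp x else 0.

Lemma frht_kernel_profile x xi : 0 < xi -> frht_kernel mu alpha x xi =
  C * chirp xi * (2 `^ (- mu) * (xi * c) `^ (mu + 1 / 2))%:C * frht_profile xi x.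
Proof.
move=> xi0; rewrite /frht_profile; have [x0|x0] := ltP 0 x; last first.
  rewrite /frht_kernel ler0_sqrtr; last first.
    by rewrite -mulrA mulr_le0_ge0// ltW// mulr_gt0// cosec_gt0.
  by rewrite mul0r !mulr0.
have xc0 : 0 < xi * c by rewrite mulr_gt0// cosec_gt0.
rewrite frht_kernelE// /besselW powRM ?(ltW x0) ?(ltW xc0)// !rmorphM/=.
move: (chirp xi) (chirp x) (2 `^ _)%:C ((xi * c) `^ _)%:C (x `^ _)%:C (besselE _ _)%:C.
by move=> *; ring.
Qed.

Lemma frht_profile_unif_smooth : unif_smoothC frht_profile.
Proof.
move=> n.
have u1 : unif_smooth n (fun s x => x `^ (mu + 1 / 2) * besselE mu ((s * c * x) ^+ 2 / 4)).
  by apply: unif_smoothM; [exact: unif_smooth_powR|exact: unif_smooth_besselE].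
have [uc us] := unif_smooth_trig n (- (cotan alpha / 2)).
have e x : - (x ^+ 2 * cotan alpha / 2) = - (cotan alpha / 2) * x ^+ 2 by ring.
split.
- apply: eq_unif_smooth (unif_smoothM u1 uc) => s x _ x0.
  by rewrite /frht_profile x0 Re_realM /chirp e.
- apply: eq_unif_smooth (unif_smoothM u1 us) => s x _ x0.
  by rewrite /frht_profile x0 Im_realM /chirp e.
Qed.

Lemma frht_compact_small h : compact_distribution h ->
  (expi (xi ^+ 2 * cotan alpha / 2) * (xi `^ (3 / 2 - eta))%:C *
     frht_compact mu alpha h xi : R[i]^o) @[xi --> 0^'+] --> (0 : R[i]^o).
Proof.
move=> hh; have /andP[e1 e2] := heta.
have [B HB] := compact_distribution_bounded hh frht_profile_unif_smooth.
(* The kernel constant is put behind an opaque name, since only its modulus enters the estimate. *)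
have [A AE] : exists A, A = C by exists C.
pose nC := Normc.normc A.
pose K := nC * (2 `^ (- mu) * c `^ (mu + 1 / 2)) * `|B|.
have L : K * xi `^ (mu + 2 - eta) @[xi --> 0^'+] --> 0.
  rewrite -[X in _ --> X](mulr0 K); apply: cvgM; first exact: cvg_cst.
  by apply: powR_cvg0; lra.
apply/cvg_normcP => e e0.
have L2 : \forall xi \near 0^'+, `|0 - K * xi `^ (mu + 2 - eta)| < e.
  by move/cvgrPdist_lt : L; apply.
near=> xi.
have xi0 : 0 < xi by near: xi; exact: nbhs_right_gt.
have xi1 : xi <= 1 by near: xi; exact: nbhs_right_le.
have : `|0 - K * xi `^ (mu + 2 - eta)| < e by near: xi.
rewrite !sub0r normrN; apply: le_lt_trans; apply: le_trans (ler_norm _).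
have xi01 : 0 < xi <= 1 by rewrite xi0.
have sP := unif_smoothC_smooth frht_profile_unif_smooth xi01.
rewrite /frht_compact (_ : (fun x => _) = (fun x =>
  C * chirp xi * (2 `^ (- mu) * (xi * c) `^ (mu + 1 / 2))%:C * frht_profile xi x)); last first.
  by apply/funext => x; rewrite frht_kernel_profile.
rewrite -AE compact_distributionZ// normcN !Normc.normcM !normc_real !normc_expi (mul1r `|xi `^ _|).
rewrite mulr1 !ger0_norm ?mulr_ge0 ?powR_ge0//.
rewrite powRM ?(ltW xi0) ?(ltW cosec_gt0)//.
have -> : xi `^ (mu + 2 - eta) = xi `^ (3 / 2 - eta) * xi `^ (mu + 1 / 2).
  by rewrite -powRDpos//; congr (_ `^ _); field.
have hB : Normc.normc (h (frht_profile xi)) <= `|B|.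
  by rewrite (le_trans (HB _ xi01))// ler_norm.
rewrite [leLHS](_ : _ = nC * (2 `^ (- mu) * c `^ (mu + 1 / 2)) *
  (xi `^ (3 / 2 - eta) * xi `^ (mu + 1 / 2)) * Normc.normc (h (frht_profile xi))); last first.
  rewrite /nC; move: (Normc.normc A) (Normc.normc (h _)) (xi `^ (mu + _)) (c `^ _) (2 `^ _) => p q a b d; ring.
rewrite /K -/nC -[leRHS]mulrA [`|B| * _]mulrC [leRHS]mulrA ler_wpM2l//.
by rewrite !mulr_ge0 ?powR_ge0 ?normc_ge0.
Unshelve. all: by end_near. Qed.

Lemma cintegralZl (a : R[i]) (F : R -> R[i]) : cintegrable Rpos F ->
  cintegral Rpos (fun x => a * F x) = a * cintegral Rpos F.
Proof.
move=> [IR II]; case: a => a b.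
rewrite /cintegral; apply/eqP; rewrite eq_complex/=; apply/andP; split; apply/eqP.
- rewrite -mulNr -RintegralZD//; last exact: measurable_Rpos_completed.
  by apply: eq_Rintegral => x _; case: (F x) => p q /=; rewrite mulNr.
- rewrite -RintegralZD//; last exact: measurable_Rpos_completed.
  by apply: eq_Rintegral => x _; case: (F x) => p q /=.
Qed.

Lemma frht_fun_abelian g (delta : R[i]) :
  (forall X : R, 0 < X -> cintegrable `]0, X[ (fun x => (x `^ (mu + 1 / 2))%:C * g x)) ->
  ((expi (- (x ^+ 2 * cotan alpha / 2)) * (x `^ (eta - 1 / 2))%:C * g x
          : R[i]^o) @[x --> +oo] -->
       (delta * ((c `^ (3 / 2 - eta))%:C / C) : R[i]^o)) ->
  (expi (xi ^+ 2 * cotan alpha / 2) * (xi `^ (3 / 2 - eta))%:C *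
     frht_fun mu alpha g xi : R[i]^o) @[xi --> 0^'+] --> (delta * (Hconst mu eta)%:C : R[i]^o).
Proof.
move=> hg gl.
pose L := delta * ((c `^ (3 / 2 - eta))%:C / C).
pose u x := chirp x * g x.
pose uR x := complex.Re (u x); pose uI x := complex.Im (u x).
have c0 := cosec_gt0.
have mtrig (X : R) (T : R -> R) : continuous T ->
    measurable_fun (`]0, X[%classic : set cR) (fun x => T (- (x ^+ 2 * cotan alpha / 2))).
  move=> cT; apply: measurable_fun_completed => //; apply: measurable_funTS.
  apply: continuous_measurable_fun => x.
  apply: (@cvg_comp _ _ _ (fun x => - (x ^+ 2 * cotan alpha / 2)) T _ (nbhs (- (x ^+ 2 * cotan alpha / 2)))); last exact: cT.
  by apply: cvgN; apply: cvgM; [apply: cvgM; [exact: exprn_continuous|exact: cvg_cst]|exact: cvg_cst].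
(* Both coordinates of [chirp x * g x] are combinations of those of [g] with bounded continuous
   coefficients, hence inherit the integrability near 0. *)
have part (s1 s2 : R -> R) : (forall t, `|s1 t| <= 1) -> (forall t, `|s2 t| <= 1) ->
   continuous s1 -> continuous s2 ->
   slow_integrable mu (fun x => s1 (- (x ^+ 2 * cotan alpha / 2)) * complex.Re (g x) +
                                s2 (- (x ^+ 2 * cotan alpha / 2)) * complex.Im (g x)).
  move=> b1 b2 c1 c2 X X0; have [IR II] := hg X X0.
  have eR : (fun x => complex.Re ((x `^ (mu + 1 / 2))%:C * g x)) =
            (fun x => x `^ (mu + 1 / 2) * complex.Re (g x)).
    by apply/funext => x; exact: Re_realM.
  have eI : (fun x => complex.Im ((x `^ (mu + 1 / 2))%:C * g x)) =
            (fun x => x `^ (mu + 1 / 2) * complex.Im (g x)).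
    by apply/funext => x; exact: Im_realM.
  pose GR x := x `^ (mu + 1 / 2) * complex.Re (g x).
  pose GI x := x `^ (mu + 1 / 2) * complex.Im (g x).
  have JR : cmu.-integrable (`]0, X[%classic : set R) (EFin \o GR).
    by move: IR; rewrite -[X in _.-integrable _ X]/(EFin \o _) eR.
  have JI : cmu.-integrable (`]0, X[%classic : set R) (EFin \o GI).
    by move: II; rewrite -[X in _.-integrable _ X]/(EFin \o _) eI.
  have mX := measurable_itv_completed `]0, X[.
  have mul (s : R -> R) G : (forall t, `|s t| <= 1) -> continuous s ->
     cmu.-integrable (`]0, X[%classic : set R) (EFin \o G) ->
     cmu.-integrable (`]0, X[%classic : set R) (EFin \o (fun x => s (- (x ^+ 2 * cotan alpha / 2)) * G x)).
    move=> sb sc IG.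
    apply: (le_integrableR mX _ _ (integrable_norm IG)).
      by apply: measurable_funM; [exact: mtrig|exact: measurable_integrableR IG].
    by move=> x _; rewrite normrM /= ler_piMl.
  have := integrableZD mX 1 1 (mul _ _ b1 c1 JR) (mul _ _ b2 c2 JI).
  apply: eq_integrable => // x _ /=; congr EFin; rewrite /GR /GI !mul1r.
  move: (s1 _) (s2 _) (x `^ _) => ? ? ?; ring.
have bcos (t : R) : `|cos t| <= 1 by rewrite ler_norml cos_geN1 cos_le1.
have bsin (t : R) : `|sin t| <= 1 by rewrite ler_norml sin_geN1 sin_le1.
have bNsin (t : R) : `|- sin t| <= 1 by rewrite normrN.
have cNsin : continuous (fun t : R => - sin t) by move=> t; apply: cvgN; exact: continuous_sin.
have hR : slow_integrable mu uR.
  have := part cos (fun t => - sin t) bcos bNsin (@continuous_cos R) cNsin.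
  rewrite (_ : (fun x => _) = uR)//; apply/funext => x; rewrite /uR /u /chirp /expi.
  by case: (g x) => p q /=; rewrite mulNr.
have hI : slow_integrable mu uI.
  have := part sin cos bsin bcos (@continuous_sin R) (@continuous_cos R).
  rewrite (_ : (fun x => _) = uI)//; apply/funext => x; rewrite /uI /u /chirp /expi.
  by case: (g x) => p q /=; rewrite addrC.
have ul : ((x `^ (eta - 1 / 2))%:C * u x : R[i]^o) @[x --> +oo] --> (L : R[i]^o).
  move: gl; apply: cvg_trans; apply: near_eq_cvg; apply: nearW => x.
  by rewrite /= /u /chirp mulrA [(_ `^ _)%:C * _]mulrC.
have lR : x `^ (eta - 1 / 2) * uR x @[x --> +oo] --> complex.Re L.
  apply: cvg_trans (cvg_Re ul); apply: near_eq_cvg; apply: nearW => x.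
  by rewrite /= Re_realM.
have lI : x `^ (eta - 1 / 2) * uI x @[x --> +oo] --> complex.Im L.
  apply: cvg_trans (cvg_Im ul); apply: near_eq_cvg; apply: nearW => x.
  by rewrite /= Im_realM.
pose J (v : R -> R) k := k `^ (3 / 2 - eta) * \int[cmu]_(x in Rpos) (W (k * x) * v x).
(* The real limit is taken in [k = xi c], so positivity has to be preserved along with convergence
   to 0. *)
have scale0 : (fun xi => xi * c) @ 0^'+ --> 0^'+.
  move=> P hP.
  have M : (fun xi => xi * c) @ (0 : R) --> (0 : R).
    by rewrite -[X in _ --> X](mul0r c); apply: cvgM; [exact: cvg_id|exact: cvg_cst].
  have h : \forall xi \near (0 : R), 0 < xi * c -> P (xi * c) by exact: M _ hP.
  by apply: filterS h => xi h xi0; apply: h; rewrite mulr_gt0.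
have AR : J uR (xi * c) @[xi --> 0^'+] --> complex.Re L * (2 `^ mu * Hconst mu eta).
  by apply: (cvg_comp _ _ scale0); exact: (besselW_abelian hmu heta hR lR).
have AI : J uI (xi * c) @[xi --> 0^'+] --> complex.Im L * (2 `^ mu * Hconst mu eta).
  by apply: (cvg_comp _ _ scale0); exact: (besselW_abelian hmu heta hI lI).
have AC : (J uR (xi * c) +i* J uI (xi * c) : R[i]^o) @[xi --> 0^'+] -->
    (complex.Re L * (2 `^ mu * Hconst mu eta) +i* (complex.Im L * (2 `^ mu * Hconst mu eta)) : R[i]^o).
  exact: cvg_complex.
pose D := C * (2 `^ (- mu) * c `^ (eta - 3 / 2))%:C.
have AD : (D * (J uR (xi * c) +i* J uI (xi * c)) : R[i]^o) @[xi --> 0^'+] -->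
  (D * (complex.Re L * (2 `^ mu * Hconst mu eta) +i* (complex.Im L * (2 `^ mu * Hconst mu eta))) : R[i]^o).
  exact: cvg_complexZl.
(* Three reciprocal pairs cancel: the powers of 2, the powers of [c] and the kernel constant with
   its inverse. This is why the assumed limit carries [c^(3/2 - eta) / C]. *)
have EL : D * (complex.Re L * (2 `^ mu * Hconst mu eta) +i* (complex.Im L * (2 `^ mu * Hconst mu eta)))
   = delta * (Hconst mu eta)%:C.
  have -> r : complex.Re L * r +i* (complex.Im L * r) = r%:C * L.
    by case: (L) => p q; apply/eqP; rewrite eq_complex/= !mul0r subr0 addr0 !(mulrC r) !eqxx.
  have E1 : (2 `^ (- mu))%:C * (2 `^ mu)%:C = 1 :> R[i].
    by rewrite -rmorphM/= -powRDpos// addNr powRr0.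
  have E2 : (c `^ (eta - 3 / 2))%:C * (c `^ (3 / 2 - eta))%:C = 1 :> R[i].
    by rewrite -rmorphM/= -powRDpos// (_ : _ + _ = 0) ?powRr0//; ring.
  have E3 : C * C^-1 = 1 by rewrite mulfV// frht_const_neq0.
  move: (Hconst mu eta) => H0; rewrite /D /L !rmorphM/=.
  move: E1 E2 E3; move: (2 `^ (- mu))%:C (2 `^ mu)%:C (c `^ (eta - 3 / 2))%:C (c `^ (3 / 2 - eta))%:C.
  move: (C) (C^-1) H0%:C => a b H p1 p2 q1 q2 E1 E2 E3.
  transitivity (delta * H * (p1 * p2) * (q1 * q2) * (a * b)); first by ring.
  by rewrite E1 E2 E3 !mulr1.
rewrite EL in AD; apply: cvg_trans AD; apply: near_eq_cvg; near=> xi.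
have xi0 : 0 < xi by near: xi; exact: nbhs_right_gt.
have k0 : 0 < xi * c by rewrite mulr_gt0.
have IR := integrable_besselW_slow hmu heta hR lR k0.
have II := integrable_besselW_slow hmu heta hI lI k0.
rewrite /frht_fun.
pose F x := (W (xi * c * x))%:C * u x.
have IF : cintegrable Rpos F.
  split.
  - by apply: eq_integrable IR => //; [exact: measurable_Rpos_completed|move=> x _; rewrite /F Re_realM].
  - by apply: eq_integrable II => //; [exact: measurable_Rpos_completed|move=> x _; rewrite /F Im_realM].
have -> : cintegral Rpos (fun x => frht_kernel mu alpha x xi * g x) =
   cintegral Rpos (fun x => (C * chirp xi * (2 `^ (- mu))%:C) * F x).
  rewrite /cintegral; congr (_ +i* _); apply: eq_Rintegral => x; rewrite inE/= in_itv/= andbT => x0;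
  by rewrite frht_kernelE// /F /u !mulrA.
rewrite cintegralZl//.
have -> : cintegral Rpos F = \int[cmu]_(x in Rpos) (W (xi * c * x) * uR x) +i*
    \int[cmu]_(x in Rpos) (W (xi * c * x) * uI x).
  rewrite /cintegral; congr (_ +i* _); apply: eq_Rintegral => x _.
  - by rewrite /F Re_realM.
  - by rewrite /F Im_realM.
rewrite /D /J.
move: (\int[cmu]_(x in Rpos) (W (xi * c * x) * uR x)) (\int[cmu]_(x in Rpos) (W (xi * c * x) * uI x)) => a b.
have -> p : p * a +i* (p * b) = p%:C * (a +i* b).
  by apply/eqP; rewrite eq_complex/= !mul0r subr0 addr0 !eqxx.
(* The real limit is normalised by [(xi c)^(3/2 - eta)], the claim by [xi^(3/2 - eta)]; the surplus
   power of [c] is undone by the one placed in [D]. *)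
have E2 : (c `^ (eta - 3 / 2))%:C * (c `^ (3 / 2 - eta))%:C = 1 :> R[i].
  by rewrite -rmorphM/= -powRDpos// (_ : _ + _ = 0) ?powRr0//; ring.
have E3 := chirp_normalizer xi.
rewrite powRM ?(ltW xi0) ?(ltW c0)// !rmorphM/=.
move: E2 E3; move: (expi _) (chirp xi) (c `^ (eta - 3 / 2))%:C (c `^ (3 / 2 - eta))%:C.
move: (C) (2 `^ (- mu))%:C (xi `^ (3 / 2 - eta))%:C (a +i* b) => A p q v e1 e2 c1 c2 E2 E3.
transitivity (A * p * q * v * (c1 * c2)); first by ring.
by rewrite E2 -E3; ring.
Unshelve. all: by end_near. Qed.

End FractionalHankelAbelian.

Theorem theorem5p7 (R : realType) (mu alpha eta : R) (delta : R[i])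
    (f h : (R -> R[i]) -> R[i]) (g : R -> R[i])
    (hmu : - (1 / 2) <= mu)
    (halpha : 0 < alpha < pi)
    (heta : 3 / 2 < eta < mu + 2)
    (hf : Kmu_dual mu f)
    (hh : compact_distribution h)
    (hfgh : forall phi : R -> R[i], Kmu mu phi -> f phi = pairing g phi + h phi)
    (hg_int : forall X : R, 0 < X ->
       cintegrable `]0, X[ (fun x => (x `^ (mu + 1 / 2))%:C * g x))
    (hg_lim :
       (expi (- (x ^+ 2 * cotan alpha / 2)) * (x `^ (eta - 1 / 2))%:C * g x
          : R[i]^o) @[x --> +oo] -->
       (delta * ((cosec alpha `^ (3 / 2 - eta))%:C / frht_const alpha mu)
          : R[i]^o)) :
  (expi (xi ^+ 2 * cotan alpha / 2) * (xi `^ (3 / 2 - eta))%:C *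
     frht_sum mu alpha g h xi : R[i]^o) @[xi --> 0^'+] -->
  (delta * (Hconst mu eta)%:C : R[i]^o).
Proof.
have A := frht_fun_abelian hmu halpha heta hg_int hg_lim.
have B := frht_compact_small hmu halpha heta hh.
rewrite -[X in _ --> X]addr0 /frht_sum; under eq_cvg do rewrite mulrDr.
exact: cvgD A B.
Qed.
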